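(* Let $k$ be a field, $R=k[x,y,z]$ with the standard grading, and let $s\geq 3$ be an even integer. Let $I\subset R$ be a homogeneous ideal of grade $3$ such that $R/I$ is compressed with $\operatorname{Soc}(R/I)\cong k(-s)\oplus k(-2s+1)$. Write $I=I_1\cap I_2$, where $I_1,I_2$ are homogeneous grade $3$ Gorenstein ideals such that $R/I_1$ and $R/I_2$ have socle degrees $s$ and $2s-1$, respectively. Assume that the only nonzero graded Betti numbers of $R/I_2$ are $\beta_{0,0}=1$, $\beta_{1,s}=s+1$, $\beta_{2,s+2}=s+1$, $\beta_{3,2s+2}=1$. Then $R/I$ has homogeneous minimal free resolution of the form $$0\to R(-2s-2)\oplus R(-s-3)\to R(-s-2)^{s+4}\to R(-s)^s\oplus R(-s-1)^3\to R .$$ In particular, the nonzero graded Betti numbers of $R/I$ are $\beta_{0,0}=1$, $\beta_{1,s}=s$, $\beta_{1,s+1}=3$, $\beta_{2,s+2}=s+4$, $\beta_{3,s+3}=1$, $\beta_{3,2s+2}=1$.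
   Context: $\beta_{i,j}=\dim_k\operatorname{Tor}_i^R(-,k)_j$. The isomorphism $\operatorname{Soc}(R/I)\cong k(-s)\oplus k(-2s+1)$ is as graded vector spaces: one basis element in degree $s$ and one in degree $2s-1$. For a homogeneous ideal $J\subset R$ with $R/J$ Artinian, let $c_\ell=\dim_k \operatorname{Soc}(R/J)_\ell$ and let $N$ be the largest integer with $(R/J)_N\neq 0$. $R/J$ is compressed if $\dim_k (R/J)_i=\min\{\binom{2+i}{i},\ \sum_{\ell=0}^{N} c_\ell\binom{2+\ell-i}{\ell-i}\}$ for $0\le i\le N$, where binomials with $\ell<i$ are $0$. A grade $3$ homogeneous Gorenstein ideal $J$ has $\operatorname{Soc}(R/J)$ one-dimensional, concentrated in a single degree called its socle degree. A decomposition $I=I_1\cap I_2$ as in the claim always exists. *)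

(* Defs.v *)
From HB Require Import structures.
From mathcomp Require Import all_boot all_algebra.
From mathcomp Require Import mpoly.

Set Implicit Arguments.
Unset Strict Implicit.
Unset Printing Implicit Defensive.

Import GRing.Theory.
Local Open Scope ring_scope.

Notation poly3 k := {mpoly k[3]}.

(* dim_k (U / (U :&: W)) = n, witnessed by a basis of U modulo W. *)
Definition subquot_dim (k : fieldType) (V : lmodType k)
    (U W : V -> Prop) (n : nat) : Prop :=
  exists b : 'I_n -> V,
    [/\ forall i, U (b i),
        forall c : 'I_n -> k, W (\sum_i c i *: b i) -> forall i, c i = 0
      & forall u, U u -> exists c : 'I_n -> k, W (u - \sum_i c i *: b i)].

(* idealr_closed includes properness (1 is not in J). *)
Definition homog_ideal (k : fieldType) (J : {pred poly3 k}) : Prop :=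
  idealr_closed J /\ forall p, p \in J -> forall d, pihomog mdeg d p \in J.

Definition in_span (k : fieldType) (fs : seq (poly3 k)) (p : poly3 k) : Prop :=
  exists c : 'I_(size fs) -> poly3 k, p = \sum_i c i * fs`_i.

Definition regular_seq (k : fieldType) (fs : seq (poly3 k)) : Prop :=
  (forall i g, (i < size fs)%N ->
     in_span (take i fs) (g * fs`_i) -> in_span (take i fs) g)
  /\ ~ in_span fs 1.

Definition has_grade (k : fieldType) (J : {pred poly3 k}) (g : nat) : Prop :=
  (exists fs, [/\ {subset fs <= J}, regular_seq fs & size fs = g])
  /\ forall fs, {subset fs <= J} -> regular_seq fs -> (size fs <= g)%N.

Definition quot_piece_dim (k : fieldType) (J : {pred poly3 k}) (i n : nat) : Prop :=
  subquot_dim (fun p : poly3 k => p \is i.-homog) (fun p => p \in J) n.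

(* The preimage in k[x,y,z] of Soc(k[x,y,z]/J), i.e. (J : (x,y,z)). *)
Definition in_socle (k : fieldType) (J : {pred poly3 k}) (p : poly3 k) : Prop :=
  forall a : 'I_3, 'X_a * p \in J.

Definition socle_piece_dim (k : fieldType) (J : {pred poly3 k}) (l n : nat) : Prop :=
  subquot_dim (fun p : poly3 k => p \is l.-homog /\ in_socle J p)
              (fun p => p \in J) n.

(* Soc(R/J) is isomorphic to the direct sum of the k(-l), l in ls, as a graded
   vector space. *)
Definition socle_shifts (k : fieldType) (J : {pred poly3 k}) (ls : seq nat) : Prop :=
  forall l, socle_piece_dim J l (count_mem l ls).

(* For a homogeneous ideal of grade 3 in k[x,y,z] the quotient is Artinian, and
   Gorenstein means Cohen-Macaulay of type 1. *)
Definition gorenstein3 (k : fieldType) (J : {pred poly3 k}) : Prop :=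
  [/\ homog_ideal J, has_grade J 3
    & subquot_dim (in_socle J) (fun p => p \in J) 1].

Definition socle_degree (k : fieldType) (J : {pred poly3 k}) (t : nat) : Prop :=
  socle_shifts J [:: t].

Definition top_degree (k : fieldType) (J : {pred poly3 k}) (N : nat) : Prop :=
  (exists2 p : poly3 k, p \is N.-homog & p \notin J)
  /\ forall i (p : poly3 k), (N < i)%N -> p \is i.-homog -> p \in J.

Definition compressed (k : fieldType) (J : {pred poly3 k}) : Prop :=
  exists (N : nat) (c : nat -> nat),
    [/\ top_degree J N,
        forall l, socle_piece_dim J l (c l)
      & forall i, (i <= N)%N ->
          quot_piece_dim J i
            (minn 'C(2 + i, i)
                  (\sum_(l < N.+1 | i <= l) c l * 'C(2 + l - i, l - i)))%N].

(* The data of a graded complex ... -> F_1 -> F_0 -> R of free modules with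
   F_i the direct sum of the R(-d), d in shifts i. Elements of F_i are row
   vectors and maps act on the right. Since R/J lives in nonnegative degrees,
   natural number shifts suffice. *)
Record gfree (k : fieldType) := GFree {
  shifts : nat -> seq nat;
  diff : forall i, 'M[poly3 k]_(size (shifts i.+1), size (shifts i));
  aug : 'M[poly3 k]_(size (shifts 0), size [:: 0%N])
}.

(* A is a degree 0 map from the sum of the R(-d_a) to the sum of the R(-e_b):
   the entry (a, b) is zero or homogeneous of degree d_a - e_b. *)
Definition homog_mx (k : fieldType) (d e : seq nat)
    (A : 'M[poly3 k]_(size d, size e)) : Prop :=
  forall a b, {in msupp (A a b), forall m, mdeg m + nth 0 e b = nth 0 d a}%N.

(* F resolves R/J, through the composite of aug : F_0 -> R with R -> R/J. *)
Definition resolves (k : fieldType) (F : gfree k) (J : {pred poly3 k}) : Prop :=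
  [/\ (forall i, homog_mx (diff F i)) /\ homog_mx (aug F),
      exists v : 'rV_(size (shifts F 0)), 1 - (v *m aug F) 0 0 \in J,
      forall v : 'rV_(size (shifts F 0)),
        (v *m aug F) 0 0 \in J <-> exists u, v = u *m diff F 0
    & forall i (v : 'rV_(size (shifts F i.+1))),
        v *m diff F i = 0 <-> exists u, v = u *m diff F i.+1].

(* The differentials have image in (x,y,z)F. *)
Definition minimal (k : fieldType) (F : gfree k) : Prop :=
  forall i a b, (diff F i a b)@_0%MM = 0.

(* F tensored with k = R/(x,y,z). *)
Definition diffk (k : fieldType) (F : gfree k) (i : nat) :
    'M[k]_(size (shifts F i.+1), size (shifts F i)) :=
  map_mx (mcoeff 0%MM) (diff F i).

Definition in_degree (k : fieldType) (d : seq nat) (j : nat)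
    (v : 'rV[k]_(size d)) : Prop :=
  forall a, v 0 a != 0 -> nth 0%N d a = j.

Definition tor_cycle (k : fieldType) (F : gfree k) (i j : nat) :
    'rV[k]_(size (shifts F i)) -> Prop :=
  match i with
  | 0 => fun v => in_degree j v
  | i'.+1 => fun v => in_degree j v /\ v *m diffk F i' = 0
  end.

Definition tor_boundary (k : fieldType) (F : gfree k) (i j : nat)
    (v : 'rV[k]_(size (shifts F i))) : Prop :=
  exists2 u : 'rV_(size (shifts F i.+1)), in_degree j u & v = u *m diffk F i.

(* dim_k Tor_i(R/J, k)_j = beta i j for all i, j. Tor is the homology of F
   tensored with k, for a graded free resolution F of R/J; it does not depend
   on F. *)
Definition betti_numbers (k : fieldType) (J : {pred poly3 k})
    (beta : nat -> nat -> nat) : Prop :=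
  exists2 F : gfree k, resolves F J &
    forall i j, subquot_dim (@tor_cycle k F i j) (@tor_boundary k F i j) (beta i j).

(* The table with value b at (i, j) for each (i, j, b) in es, and 0 elsewhere;
   the positions (i, j) are meant to be distinct. *)
Definition betti_table (es : seq (nat * nat * nat)) (i j : nat) : nat :=
  \sum_(e <- es | e.1 == (i, j)) e.2.

(* Main.v *)
Require Import Defs.
From HB Require Import structures.
From mathcomp Require Import all_boot all_algebra.
From mathcomp Require Import mpoly zify ring.

(* Let J = I_2.  The ideals I and J differ only in degree s, where I_s has
   codimension one in J_s: I_1 contains all forms of degree > s, so I and J agree
   there, and a socle generator b of R/I in degree s lies in J (R/J has no socle
   in degree s) and spans J_s modulo I_s.  Hence I = (I_s) + (x, y, z) b, and the
   resolution of R/I is the mapping cone of a resolution of R/J with the Koszul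
   complex of J/I = k(-s), after cancelling the unit entry at b.

   Of the Betti numbers of R/J only two vanishing statements are used: Tor_1 is
   concentrated in degree s and Tor_2 in degree s + 2.  By graded Nakayama they
   say that J is generated by J_s and that its syzygies are generated by the
   quadratic ones.  The Hilbert function of J is known from the compressedness of
   R/I, and counting dimensions then gives s + 1 quadratic syzygies, whose own
   syzygies have the Hilbert function of R(-2s-2) and so are generated by any
   nonzero element of least degree. *)

Set Implicit Arguments.
Unset Strict Implicit.
Unset Printing Implicit Defensive.

Import GRing.Theory.
Local Open Scope ring_scope.

(** * Homogeneous matrices *)

Lemma mcoeff_pihomog n (R : nzRingType) d (p : {mpoly R[n]}) m :
  (pihomog mdeg d p)@_m = if mdeg m == d then p@_m else 0.
Proof.
elim/mpolyind: p => [|c m' p _ _ IH]; first by rewrite pihomog0 mcoeff0 if_same.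
rewrite pihomogD linearZ /= !mcoeffD !mcoeffZ IH pihomogX mcoeffX.
case: (eqVneq m' m) => [->|ne].
  by case: ifP => _; rewrite ?mcoeffX ?eqxx // mcoeff0 mulr0 addr0.
rewrite (fun_if (mcoeff m)) mcoeffX mcoeff0 (negPf ne) if_same mulr0 !add0r.
by [].
Qed.

Lemma homog0_mpolyC n (R : nzRingType) (p : {mpoly R[n]}) :
  p \is 0.-homog -> p = (p@_0%MM)%:MP.
Proof.
move=> hp; apply/mpolyP => m; rewrite mcoeffC.
case: (eqVneq m 0%MM) => [->|ne]; rewrite ?mulr1 // mulr0.
by apply: (dhomog_nemf_coeff hp); rewrite mdeg_eq0.
Qed.

Section HomogeneousMatrices.

Variable k : fieldType.
Local Notation R := (poly3 k).

(* This is homog_mx, with the shifts given by functions instead of lists. *)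
Definition homogmx m n (d : 'I_m -> nat) (e : 'I_n -> nat)
    (A : 'M[R]_(m, n)) : Prop :=
  forall a b, {in msupp (A a b), forall p, mdeg p + e b = d a}%N.

(** The degree-preserving part of a matrix seen as a map of graded free modules. The guard matters
    because truncated subtraction would otherwise keep the constant term of entries with
    [d a < e b]. *)
Definition hcomp m n (d : 'I_m -> nat) (e : 'I_n -> nat)
    (A : 'M[R]_(m, n)) : 'M[R]_(m, n) :=
  \matrix_(a, b)
    (if (e b <= d a)%N then pihomog mdeg (d a - e b) (A a b) else 0).

Lemma mcoeff_hcomp m n d e (A : 'M[R]_(m, n)) a b p :
  (hcomp d e A a b)@_p = if (mdeg p + e b == d a)%N then (A a b)@_p else 0.
Proof.
rewrite mxE; case: leqP => [le|lt]; last first.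
  by rewrite mcoeff0 gtn_eqF // (leq_trans lt) ?leq_addl.
by rewrite mcoeff_pihomog -(eqn_add2r (e b)) subnK.
Qed.

Lemma homogmx_coef m n d e (A : 'M[R]_(m, n)) :
  homogmx d e A <->
  forall a b p, (A a b)@_p != 0 -> (mdeg p + e b = d a)%N.
Proof.
split=> h a b p; first by rewrite -mcoeff_msupp; apply: h.
by rewrite mcoeff_msupp; apply: h.
Qed.

Lemma homogmx_dhomog m n d e (A : 'M[R]_(m, n)) a b :
  homogmx d e A -> A a b \is (d a - e b).-homog.
Proof. by move=> h; apply/dhomogP => p /h <-; rewrite addnK. Qed.

Lemma dhomog_homogmx m n d e (A : 'M[R]_(m, n)) :
  (forall a b, (e b <= d a)%N /\ A a b \is (d a - e b).-homog \/ A a b = 0) ->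
  homogmx d e A.
Proof.
move=> h a b p; case: (h a b) => [[le /dhomogP hA] /hA -> |->].
  by rewrite subnK.
by rewrite msupp0.
Qed.

Lemma homogmx_hcomp m n d e (A : 'M[R]_(m, n)) : homogmx d e (hcomp d e A).
Proof.
apply/homogmx_coef => a b p; rewrite mcoeff_hcomp.
by case: ifP => [/eqP -> | _] //; rewrite eqxx.
Qed.

Lemma hcomp_id m n d e (A : 'M[R]_(m, n)) : homogmx d e A -> hcomp d e A = A.
Proof.
move/homogmx_coef=> h; apply/matrixP => a b; apply/mpolyP => p.
rewrite mcoeff_hcomp; case: eqP => // ne; apply/esym/eqP/contraT.
by move/h.
Qed.

Lemma hcompD m n d e (A B : 'M[R]_(m, n)) :
  hcomp d e (A + B) = hcomp d e A + hcomp d e B.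
Proof.
apply/matrixP => a b; rewrite !mxE; case: ifP => _; rewrite ?addr0 //.
by rewrite linearD.
Qed.

Lemma hcomp0 m n d e : hcomp d e (0 : 'M[R]_(m, n)) = 0.
Proof.
by apply/matrixP => a b; rewrite !mxE; case: ifP => _; rewrite ?linear0.
Qed.

Lemma hcompN m n d e (A : 'M[R]_(m, n)) : hcomp d e (- A) = - hcomp d e A.
Proof.
by apply/matrixP => a b; rewrite !mxE; case: ifP => _; rewrite ?linearN ?oppr0.
Qed.

(** A nonzero coefficient of [B] fixes the degree of its monomial, so in each term of the product
    the degree condition moves to the factor from [A]. Hence a solution of a homogeneous linear
    equation can be replaced by a homogeneous one. *)
Lemma hcompM m n l d e f (A : 'M[R]_(m, n)) (B : 'M[R]_(n, l)) :
  homogmx e f B -> hcomp d f (A *m B) = hcomp d e A *m B.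
Proof.
move/homogmx_coef=> hB; apply/matrixP => a b; apply/mpolyP => p.
rewrite mcoeff_hcomp !mxE !raddf_sum /=.
have eqc j : (hcomp d e A a j * B j b)@_p =
    if (mdeg p + f b == d a)%N then (A a j * B j b)@_p else 0.
  rewrite !mcoeffM; set c := (_ + f b == _)%N.
  transitivity (\sum_(q : 'X_{1..3 < (mdeg p).+1, (mdeg p).+1} | p == (q.1 + q.2)%MM)
     (if c then (A a j)@_q.1 * (B j b)@_q.2 else 0)); last first.
    by case: c; rewrite // big1.
  apply: eq_bigr => q /eqP def_p; rewrite mcoeff_hcomp.
  case: (eqVneq (B j b)@_q.2 0) => [->|/hB h2].
    by rewrite !mulr0 if_same.
  have -> : (mdeg q.1 + e j == d a)%N = c.
    have dp : mdeg p = (mdeg q.1 + mdeg q.2)%N by rewrite -mdegD -def_p.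
    by rewrite /c [in RHS]dp -addnA h2.
  by case: c; rewrite ?mul0r.
rewrite (eq_bigr _ (fun j _ => eqc j)).
by case: ifP => _ //; rewrite big1.
Qed.

Lemma homogmxM m n l d e f (A : 'M[R]_(m, n)) (B : 'M[R]_(n, l)) :
  homogmx d e A -> homogmx e f B -> homogmx d f (A *m B).
Proof.
move=> hA hB; rewrite -(hcomp_id hA) -(hcompM _ _ hB); exact: homogmx_hcomp.
Qed.

Lemma homogmx_scalar n (d e : 'I_n -> nat) i (p : R) :
  p \is i.-homog -> (forall b, d b = e b + i)%N -> homogmx d e p%:M.
Proof.
move=> hp hd; apply: dhomog_homogmx => a b; rewrite mxE.
case: eqP => [<-|_]; last by right.
by left; rewrite hd addKn leq_addr.
Qed.

Lemma sum_hcomp n (e : 'I_n -> nat) (v : 'rV[R]_n) :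
  exists N, v = \sum_(j < N) hcomp (fun=> val j) e v.
Proof.
(* This exceeds every degree [mdeg p + e b] with p in the support of entry b. *)
exists (\sum_b (msize (v 0%R b) + e b)).+1.
apply/matrixP => a b; rewrite ord1 summxE.
apply/mpolyP => p; rewrite raddf_sum /=.
case: (eqVneq (v 0 b)@_p 0) => [z|nz].
  by rewrite big1 // => i _; rewrite mcoeff_hcomp z if_same.
have lt : (mdeg p + e b < (\sum_b (msize (v 0%R b) + e b)).+1)%N.
  rewrite ltnS (bigD1 b) //= -addnA leq_add ?leq_addr //.
  by apply/ltnW/msize_mdeg_lt; rewrite mcoeff_msupp.
rewrite (bigD1 (Ordinal lt)) //= mcoeff_hcomp eqxx big1 ?addr0 // => i ne.
rewrite mcoeff_hcomp; case: eqP => // h; case/eqP: ne; exact: val_inj.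
Qed.

Lemma homog_ideal_hcomp (J : {pred R}) (v : 'rV[R]_1) d e :
  homog_ideal J -> v 0 0 \in J -> (hcomp d e v) 0 0 \in J.
Proof.
move=> [[J0 _ _] hJ] hv; rewrite mxE; case: ifP => _ //; exact: hJ.
Qed.

(** A nonzero constant has degree 0, which would force [d a = e b]. Minimality of the final
    resolution is read off its shifts in this way. *)
Lemma mcoeff0_eq0 m n (d : 'I_m -> nat) (e : 'I_n -> nat) (A : 'M[R]_(m, n)) :
  homogmx d e A -> (forall a b, d a != e b) ->
  map_mx (mcoeff 0%MM) A = 0.
Proof.
move/homogmx_coef=> h ne; apply/matrixP => a b; rewrite !mxE.
apply/eqP/contraT => /h; rewrite mdeg0 add0n => eq.
by case/eqP: (ne a b).
Qed.

Lemma mpoly3_maxl (p : R) :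
  p@_0%MM = 0 -> exists q : 'I_3 -> R, p = \sum_a 'X_a * q a.
Proof.
elim/mpolyind: p => [_|c m p m_p nz_c IH].
  by exists (fun=> 0); rewrite big1 // => a _; rewrite mulr0.
rewrite mcoeffD mcoeffZ mcoeffX.
(* If m = 1, then 1 is not in the support of p, so the constant coefficient of the sum is c, which
   is nonzero. *)
case: (eqVneq m 0%MM) => [m0|nz_m].
  by rewrite -m0 (memN_msupp_eq0 m_p) mulr1 addr0 => /eqP; rewrite (negPf nz_c).
rewrite mulr0 add0r => /IH [q ->].
have [a ma] : exists a, m a != 0%N.
  apply/existsP; apply: contra_neqT nz_m; rewrite negb_exists => /forallP h.
  by apply/mnmP => i; rewrite mnm0E; apply/eqP; have := h i; rewrite negbK.
exists (fun i => q i + (if i == a then c *: 'X_[m - U_(a)] else 0)).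
under [RHS]eq_bigr => i _ do rewrite mulrDr.
rewrite big_split /= addrC; congr (_ + _).
rewrite (bigD1 a) //= eqxx big1 ?addr0; last first.
  by move=> i /negPf ->; rewrite mulr0.
rewrite -scalerAr -mpolyXD addmC submK //.
by apply/mnm_lepP => i; rewrite mnm1E; case: eqP => // <-; rewrite lt0n.
Qed.

End HomogeneousMatrices.

Arguments homogmx_hcomp {k m n} d e A a b.

(** * Graded Nakayama lemma and vanishing of Tor *)

Section GradedNakayama.

Variable k : fieldType.
Local Notation R := (poly3 k).

Lemma mx_maxl m n (A : 'M[R]_(m, n)) :
  map_mx (mcoeff 0%MM) A = 0 ->
  exists B : 'I_3 -> 'M[R]_(m, n), A = \sum_a 'X_a *: B a.
Proof.
move=> A0.
have ex (ij : 'I_m * 'I_n) :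
    exists q : 'I_3 -> R, A ij.1 ij.2 = \sum_a 'X_a * q a.
  by apply: mpoly3_maxl; have /matrixP/(_ ij.1 ij.2) := A0; rewrite !mxE.
have [q hq] := fin_all_exists ex.
exists (fun a => \matrix_(i, j) q (i, j) a).
apply/matrixP => i j; rewrite (hq (i, j)) summxE.
by apply: eq_bigr => a _; rewrite !mxE.
Qed.

Lemma hcompX n (e : 'I_n -> nat) j a (v : 'rV[R]_n) :
  hcomp (fun=> j.+1) e ('X_a *: v) = 'X_a *: hcomp (fun=> j) e v.
Proof.
rewrite -!mul_mx_scalar (@hcompM _ _ _ _ _ (fun b => (e b).+1)).
  by congr (_ *m _); apply/matrixP => i b; rewrite !mxE ltnS subSS.
by apply: (@homogmx_scalar _ _ _ _ 1) => [|b]; rewrite ?addn1 // dhomogX /= mdeg1.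
Qed.

Lemma hcompX0 n (e : 'I_n -> nat) a (v : 'rV[R]_n) :
  hcomp (fun=> 0%N) e ('X_a *: v) = 0.
Proof.
rewrite -mul_mx_scalar (@hcompM _ _ _ _ _ (fun b => (e b).+1)).
  rewrite (_ : hcomp _ _ _ = 0) ?mul0mx //.
  by apply/matrixP => i b; rewrite !mxE.
by apply: (@homogmx_scalar _ _ _ _ 1) => [|b]; rewrite ?addn1 // dhomogX /= mdeg1.
Qed.

(** Induction on the degree: in v = sum x_a u_a of degree j + 1, each u_a may be replaced by its
    part of degree j, to which the induction applies; in degree 0 the sum vanishes. [P] is the
    module and [G] the submodule to be shown to contain it. *)
Lemma graded_nakayama n (e : 'I_n -> nat) (P G : 'rV[R]_n -> Prop) :
    G 0 -> (forall u v, G u -> G v -> G (u + v)) ->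
    (forall a u, G u -> G ('X_a *: u)) ->
    (forall j v, P v -> P (hcomp (fun=> j) e v)) ->
    (forall j v, P v -> homogmx (fun=> j) e v ->
       G v \/ exists2 u : 'I_3 -> 'rV[R]_n,
                forall a, P (u a) & v = \sum_a 'X_a *: u a) ->
  forall v, P v -> G v.
Proof.
move=> G0 GD GX Pc step.
have Gsum (T : Type) (r : seq T) (F : T -> 'rV_n) :
    (forall i, G (F i)) -> G (\sum_(i <- r) F i).
  by move=> h; elim/big_ind: _ => // i _.
have hc j v : P v -> homogmx (fun=> j) e v -> G v.
  elim: j v => [|j IH] v Pv hv; case: (step _ _ Pv hv) => // -[u Pu def_v];
    rewrite -(hcomp_id hv) def_v.
    rewrite (big_morph _ (hcompD _ _) (hcomp0 _ _ _)) big1 // => a _.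
    exact: hcompX0.
  rewrite (big_morph _ (hcompD _ _) (hcomp0 _ _ _)); apply: Gsum => a.
  rewrite hcompX; apply: GX; apply: IH; first exact: Pc.
  exact: homogmx_hcomp.
move=> v Pv; have [N ->] := sum_hcomp e v; apply: Gsum => j.
exact: hc (Pc _ _ Pv) (homogmx_hcomp _ _ _).
Qed.

End GradedNakayama.

Section Tor.

Variable k : fieldType.
Local Notation R := (poly3 k).

Local Notation sh d := (fun a => nth 0%N d (nat_of_ord a)).

Lemma subquot_dim0 (V : lmodType k) (U W : V -> Prop) :
  subquot_dim U W 0 -> forall u, U u -> W u.
Proof.
by move=> [b [_ _ h]] u /h [c]; rewrite big_ord0 subr0.
Qed.

Variables (F : gfree k) (J : {pred R}).
Hypotheses (resF : resolves F J) (homJ : homog_ideal J).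

Lemma diff_diff i : diff F i.+1 *m diff F i = 0.
Proof.
case: resF => _ _ _ ex; apply/row_matrixP => a.
by rewrite row_mul row0; apply/ex; exists (delta_mx 0 a); rewrite -rowE.
Qed.

Lemma diff_aug a : (diff F 0 *m aug F) a 0 \in J.
Proof.
case: resF => _ _ ex _.
have := (ex (row a (diff F 0))).2; rewrite -row_mul mxE; apply.
by exists (delta_mx 0 a); rewrite -rowE.
Qed.

(* An element of degree j of mF_i that bounds: its preimage u, taken
   homogeneous, is a cycle of F (x) k, hence a boundary modulo mF_(i+1), and
   can be corrected by a boundary of F. *)
Lemma tor_vanishing_lift i j (v : 'rV_(size (shifts F i))) :
  subquot_dim (@tor_cycle k F i.+1 j) (@tor_boundary k F i.+1 j) 0 ->
  homogmx (fun=> j) (sh (shifts F i)) v -> map_mx (mcoeff 0%MM) v = 0 ->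
  (exists u, v = u *m diff F i) ->
  exists w : 'I_3 -> 'rV_(size (shifts F i.+1)),
    v = \sum_a 'X_a *: (w a *m diff F i).
Proof.
move=> tor0 hv v0 [u0 def_v].
have [[hd _] _ _ _] := resF.
set u := hcomp (fun=> j) (sh (shifts F i.+1)) u0.
have def_v' : v = u *m diff F i by rewrite -(hcomp_id hv) def_v (hcompM _ _ (hd i)).
have cyc : @tor_cycle k F i.+1 j (map_mx (mcoeff 0%MM) u).
  split=> [a|]; last by rewrite /diffk -map_mxM -def_v'.
  rewrite mxE => nz; have /homogmx_coef/(_ _ _ _ nz) := homogmx_hcomp (fun=> j) (sh (shifts F i.+1)) u0.
  by rewrite mdeg0.
have [w _ def_w] := subquot_dim0 tor0 cyc.
have [|b def_b] := @mx_maxl k _ _ (u - map_mx (@mpolyC 3 k) w *m diff F i.+1).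
  apply/matrixP => a c; have /matrixP/(_ a c) := def_w.
  rewrite -[w in w *m _](_ : map_mx (mcoeff 0%MM) (map_mx (@mpolyC 3 k) w) = w); last first.
    by apply/matrixP => ? ?; rewrite !mxE mpolyCK.
  by rewrite /diffk -map_mxM !mxE mcoeffB => ->; rewrite subrr.
exists b; transitivity ((u - map_mx (@mpolyC 3 k) w *m diff F i.+1) *m diff F i).
  by rewrite mulmxBl -mulmxA diff_diff mulmx0 subr0.
by rewrite def_b mulmx_suml; apply: eq_bigr => a _; rewrite scalemxAl.
Qed.

(** F_0 may be larger than R, and [e] stands in for the generator 1. The degree 0 part of a preimage
    of 1 modulo J maps exactly to 1, since the error is a constant lying in a proper ideal. *)
Lemma resolution_unit :
  exists2 e : 'rV_(size (shifts F 0)),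
    homogmx (fun=> 0%N) (sh (shifts F 0)) e & e *m aug F = 1%:M.
Proof.
have [[_ ha] [e0 he0] _ _] := resF.
have [[J0 J1 JD] _] := homJ.
exists (hcomp (fun=> 0%N) (sh (shifts F 0)) e0); first exact: homogmx_hcomp.
set e := hcomp _ _ _.
pose z := sh [:: 0%N] : 'I_1 -> nat.
have eqw : 1%:M - e *m aug F = hcomp (fun=> 0%N) z (1%:M - e0 *m aug F).
  rewrite hcompD hcompN (hcompM _ _ ha) [hcomp _ z _]hcomp_id //.
  apply: (@homogmx_scalar _ _ _ _ 0); first exact: dhomog1.
  by move=> b; rewrite /z ord1.
have inJ : (1%:M - e *m aug F) 0 0 \in J.
  rewrite eqw; apply: homog_ideal_hcomp => //; move: he0; rewrite !mxE.
  by rewrite eqxx.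
have hom0 : (1%:M - e *m aug F) 0 0 \is 0.-homog.
  have := homogmx_dhomog 0 0 (homogmx_hcomp (fun=> 0%N) z (1%:M - e0 *m aug F)).
  by rewrite -eqw.
have := homog0_mpolyC hom0; set c := _@_0%MM => def_c.
have c0 : c = 0.
  apply/eqP/contraT => nz; case/negP: J1.
  have := JD c^-1%:MP _ _ inJ J0.
  by rewrite def_c addr0 -mpolyCM mulVf.
apply/esym/eqP; rewrite -subr_eq0; apply/eqP/matrixP => i j.
by rewrite !ord1 [LHS]def_c c0 mxE mpolyC0.
Qed.

Section Generators.

Variables (n s : nat) (f : 'cV[R]_n).
Hypotheses (fJ : forall i, f i 0 \in J)
  (homf : homogmx (fun=> s) (fun=> 0%N) f).

Lemma span_in_ideal (v : 'rV[R]_n) : (v *m f) 0 0 \in J.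
Proof.
have [[J0 _ JD] _] := homJ.
rewrite mxE; elim/big_ind: _ => [//|p q hp hq|i _].
  by rewrite -[p]mul1r; apply: JD.
by rewrite -[_ * _]addr0; apply: JD.
Qed.

(** For v in J, [v *m e] is a lift to F_0 that bounds. In positive degree j different from s,
    [tor_vanishing_lift] writes it as a sum of x_a times boundaries, and [aug] sends boundaries into
    J; a form of degree 0 in J is zero. Nakayama concludes. *)
Lemma tor1_generators :
    (forall p, p \in J -> p \is s.-homog -> exists v, p%:M = v *m f) ->
    (forall j, j != s ->
      subquot_dim (@tor_cycle k F 1 j) (@tor_boundary k F 1 j) 0) ->
  forall p, p \in J -> exists v, p%:M = v *m f.
Proof.
move=> span_s tor1 p pJ.
have [e he e1] := resolution_unit.
have [_ _ ex0 _] := resF.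
have [[J0 J1 JD] hJ] := homJ.
pose P (v : 'rV[R]_1) := v 0 0 \in J.
pose G (v : 'rV[R]_1) := exists u, v = u *m f.
suff: G p%:M by [].
apply: (@graded_nakayama k 1 (fun=> 0%N) P G).
- by exists 0; rewrite mul0mx.
- by move=> _ _ [u ->] [v ->]; exists (u + v); rewrite mulmxDl.
- by move=> a _ [u ->]; exists ('X_a *: u); rewrite scalemxAl.
- by move=> j v; apply: homog_ideal_hcomp.
- move=> j v Pv hv; case: (eqVneq j s) => [eqj|ne].
    left; have := span_s _ Pv; rewrite -mx11_scalar; apply.
    by have := homogmx_dhomog 0 0 hv; rewrite eqj subn0.
  case: j => [|j] in ne hv *.
    left; exists 0; rewrite mul0mx.
    have v0 : v 0 0 = ((v 0 0)@_0%MM)%:MP.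
      by apply/homog0_mpolyC/(homogmx_dhomog 0 0 hv).
    rewrite [v]mx11_scalar; case: (eqVneq (v 0 0)@_0%MM 0) => [z|nz].
      by rewrite v0 z mpolyC0 raddf0.
    case/negP: J1; have := JD ((v 0 0)@_0%MM)^-1%:MP _ _ Pv J0.
    by rewrite {2}v0 addr0 -mpolyCM mulVf.
  right.
  have hve : homogmx (fun=> j.+1) (sh (shifts F 0)) (v *m e).
    exact: homogmxM hv he.
  have [||w hw] := tor_vanishing_lift (tor1 _ ne) hve.
  - by rewrite map_mxM (mcoeff0_eq0 hv) ?mul0mx.
  - by apply/ex0; rewrite -mulmxA e1 mulmx1; exact: Pv.
  exists (fun a => w a *m diff F 0 *m aug F) => [a|].
    by rewrite /P; apply/ex0; exists (w a).
  rewrite -[LHS]mulmx1 -e1 mulmxA hw mulmx_suml.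
  by apply: eq_bigr => a _; rewrite -scalemxAl.
- by rewrite /P mxE.
Qed.

(* phi and psi compare F with the presentation of J by f; psi *m phi is the
   identity modulo syzygies, so a syzygy in m that lifts into m.im(F_2) lies in
   m times the syzygies. *)
Lemma tor2_syzygies (G : 'rV[R]_n -> Prop) d :
    (forall p, p \in J -> exists v, p%:M = v *m f) ->
    G 0 -> (forall u v, G u -> G v -> G (u + v)) ->
    (forall a u, G u -> G ('X_a *: u)) ->
    (forall v : 'rV[R]_n, homogmx (fun=> s) (fun=> s) v -> v *m f = 0 -> v = 0) ->
    (forall v : 'rV[R]_n, homogmx (fun=> d) (fun=> s) v -> v *m f = 0 -> G v) ->
    (forall j, j != d ->
      subquot_dim (@tor_cycle k F 2 j) (@tor_boundary k F 2 j) 0) ->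
  forall v, v *m f = 0 -> G v.
Proof.
move=> gen G0 GD GX free_s Gd tor2.
have [e he e1] := resolution_unit.
have [[hd _] _ ex0 ex] := resF.
(* Both comparison maps are chosen row by row. [phi] is left inhomogeneous, as the vectors handed to
   Nakayama only have to be syzygies. *)
have [psi hpsi psiE] : exists2 psi : 'M_(n, size (shifts F 1)),
    homogmx (fun=> s) (sh (shifts F 1)) psi & psi *m diff F 0 = f *m e.
  have exr (i : 'I_n) : exists u : 'rV_(size (shifts F 1)), row i f *m e = u *m diff F 0.
    apply/ex0; rewrite -mulmxA e1 mulmx1 mxE; exact: fJ.
  have [u hu] := fin_all_exists exr.
  exists (hcomp (fun=> s) (sh (shifts F 1)) (\matrix_i u i)).
    exact: homogmx_hcomp.
  rewrite -(hcompM _ _ (hd 0%N)) -[RHS](hcomp_id (homogmxM homf he)).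
  congr hcomp; apply/row_matrixP => i.
  by rewrite !row_mul rowK hu.
have [phi phiE] : exists phi : 'M_(size (shifts F 1), n),
    phi *m f = diff F 0 *m aug F.
  have exr i : exists v : 'rV_n, row i (diff F 0 *m aug F) = v *m f.
    have [v hv] := gen _ (diff_aug i); exists v; rewrite -hv.
    by apply/matrixP => a b; rewrite !ord1 !mxE eqxx.
  have [v hv] := fin_all_exists exr; exists (\matrix_i v i).
  by apply/row_matrixP => i; rewrite row_mul rowK hv.
pose P (v : 'rV[R]_n) := v *m f = 0.
apply: (@graded_nakayama k n (fun=> s) P G) => // [j v Pv|j v Pv hv].
  by rewrite /P -(hcompM _ _ homf) Pv hcomp0.
case: (eqVneq j s) => [eqj|nes].
  by left; rewrite eqj in hv; rewrite (free_s v hv Pv).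
case: (eqVneq j d) => [eqj|ned]; first by left; rewrite eqj in hv; exact: Gd hv Pv.
right.
have v0 : map_mx (mcoeff 0%MM) v = 0 by apply: mcoeff0_eq0 hv _.
have hvp : homogmx (fun=> j) (sh (shifts F 1)) (v *m psi).
  exact: homogmxM hv hpsi.
have [||w hw] := tor_vanishing_lift (tor2 _ ned) hvp.
- by rewrite map_mxM v0 mul0mx.
- by apply/ex; rewrite -mulmxA psiE mulmxA Pv mul0mx.
have [u hu] := mx_maxl v0.
(* The two summands come from v = v psi phi + v (1 - psi phi). *)
exists (fun a => w a *m diff F 1 *m phi + u a *m (1%:M - psi *m phi)) => [a|].
  rewrite /P mulmxDl -!mulmxA phiE [diff F 1 *m _]mulmxA diff_diff mul0mx mulmx0 add0r.
  rewrite mulmxBl mul1mx -mulmxA phiE mulmxA psiE -mulmxA e1 mulmx1 subrr.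
  by rewrite mulmx0.
rewrite -[LHS](subrK (v *m psi *m phi)) addrC {1}hw.
rewrite mulmx_suml -mulmxA -{1}[v]mulmx1 -mulmxBr [X in X *m (_ - _)]hu.
rewrite mulmx_suml -big_split; apply: eq_bigr => a _.
by rewrite scalerDr -!scalemxAl.
Qed.

End Generators.

End Tor.

(** * Minimal resolutions of length three *)

Section Resolutions.

Variable k : fieldType.
Local Notation R := (poly3 k).

Lemma in_degree_dim (d : seq nat) j :
  subquot_dim (fun v : 'rV[k]_(size d) => in_degree j v)
              (fun v : 'rV[k]_(size d) => v = 0) (count_mem j d).
Proof.
have card_d : #|[pred a : 'I_(size d) | nth 0%N d a == j]| = count_mem j d.
  rewrite -sum1_card -sum1_count (big_nth 0%N) big_mkord.
  by apply: eq_bigl => a.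
rewrite -card_d; set A := [pred a : 'I_(size d) | _].
exists (fun i : 'I_#|A| => delta_mx 0 (enum_val i)).
have sumE (c : 'I_#|A| -> k) a :
    (\sum_i c i *: delta_mx 0 (enum_val i) : 'rV_(size d)) 0 a =
    \sum_i (if a == enum_val i then c i else 0).
  rewrite summxE; apply: eq_bigr => i _; rewrite !mxE eqxx /=.
  by case: eqP; rewrite ?mulr1 ?mulr0.
have sumA (c : 'I_#|A| -> k) i :
    (\sum_i c i *: delta_mx 0 (enum_val i) : 'rV_(size d)) 0 (enum_val i) = c i.
  rewrite sumE (bigD1 i) //= eqxx big1 ?addr0 // => l ne.
  by rewrite (inj_eq enum_val_inj) eq_sym (negPf ne).
split=> [i a|c /matrixP z i|u hu].
- rewrite mxE eqxx /=; case: (a =P _) => [-> _|_]; last by rewrite eqxx.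
  exact/eqP/(enum_valP i).
- by rewrite -sumA z mxE.
- exists (fun i => u 0 (enum_val i)).
  apply/eqP; rewrite subr_eq0; apply/eqP/matrixP => i a; rewrite ord1.
  case: (boolP (a \in A)) => [aA|aA].
    by rewrite -(enum_rankK_in aA aA) sumA.
  rewrite sumE big1 => [|l _].
    by apply/eqP; apply: contraNT aA => /hu /eqP.
  by case: (a =P _) => // al; case/negP: aA; rewrite al; exact: enum_valP.
Qed.

Lemma subquot_dim_ext (V : lmodType k) (U U' W W' : V -> Prop) n :
  (forall v, U v <-> U' v) -> (forall v, W v <-> W' v) ->
  subquot_dim U W n -> subquot_dim U' W' n.
Proof.
move=> eU eW [b [bU bW bg]]; exists b; split=> [i|c /eW|u /eU /bg [c hc]].
- exact/eU.
- exact: bW.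
- by exists c; apply/eW.
Qed.

(** Minimality makes the differentials vanish after tensoring with k, so Tor_i is F_i tensored with
    k, and its dimensions count shifts. *)
Lemma minimal_betti (F : gfree k) (J : {pred R}) (beta : nat -> nat -> nat) :
  resolves F J -> minimal F ->
  (forall i j, beta i j = count_mem j (shifts F i)) ->
  betti_numbers J beta.
Proof.
move=> resF minF hb; exists F => // i j; rewrite hb.
have dk0 l : diffk F l = 0.
  by apply/matrixP => a b; rewrite !mxE; exact: minF.
apply: subquot_dim_ext (in_degree_dim _ _) => v.
  by case: i v => [|i] v //=; rewrite dk0 mulmx0; split=> [|[]].
split=> [->|[u _ ->]]; last by rewrite dk0 mulmx0.
by exists 0; rewrite ?mul0mx // => a; rewrite mxE eqxx.
Qed.

Definition shifts3 (d1 d2 d3 : seq nat) (i : nat) : seq nat :=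
  match i with 0 => [:: 0] | 1 => d1 | 2 => d2 | 3 => d3 | _ => [::] end%N.

(** The sizes are tied to the lists of shifts by equations only, so that block matrices, whose
    dimensions are sums, can be supplied directly. *)
Lemma length3_resolution (J : {pred R}) (d1 d2 d3 : seq nat) n1 n2 n3
    (D0 : 'cV[R]_n1) (D1 : 'M[R]_(n2, n1)) (D2 : 'M[R]_(n3, n2)) :
  size d1 = n1 -> size d2 = n2 -> size d3 = n3 ->
  0 \in J ->
  homogmx (fun a => nth 0%N d1 a) (fun=> 0%N) D0 ->
  homogmx (fun a => nth 0%N d2 a) (fun a => nth 0%N d1 a) D1 ->
  homogmx (fun a => nth 0%N d3 a) (fun a => nth 0%N d2 a) D2 ->
  map_mx (mcoeff 0%MM) D0 = 0 -> map_mx (mcoeff 0%MM) D1 = 0 ->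
  map_mx (mcoeff 0%MM) D2 = 0 ->
  (forall p, p \in J <-> exists v, p%:M = v *m D0) ->
  (forall v : 'rV_n1, v *m D0 = 0 <-> exists u, v = u *m D1) ->
  (forall v : 'rV_n2, v *m D1 = 0 <-> exists u, v = u *m D2) ->
  (forall v : 'rV_n3, v *m D2 = 0 -> v = 0) ->
  exists F : gfree k,
    [/\ resolves F J, minimal F & shifts F = shifts3 d1 d2 d3].
Proof.
move=> e1 e2 e3; case: _ / e1 in D0 D1 *; case: _ / e2 in D1 D2 *.
case: _ / e3 in D2 * => J0 h0 h1 h2 c0 c1 c2 ex0 ex1 ex2 ex3.
pose D i : 'M[R]_(size (shifts3 d1 d2 d3 i.+1), size (shifts3 d1 d2 d3 i)) :=
  match i with 0 => D0 | 1 => D1 | 2 => D2 | _ => 0 end.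
exists (@GFree k (shifts3 d1 d2 d3) D 1%:M); split=> //; last first.
  move=> [|[|[|i]]] a b /=; last by rewrite mxE mcoeff0.
  - by have /matrixP/(_ a b) := c0; rewrite !mxE.
  - by have /matrixP/(_ a b) := c1; rewrite !mxE.
  - by have /matrixP/(_ a b) := c2; rewrite !mxE.
split.
- split.
    move=> [|[|[|i]]] a b m //=; last by rewrite mxE msupp0.
    + by rewrite ord1; exact: h0.
    + exact: h1.
    + exact: h2.
  move=> /= a b m; rewrite !ord1 mxE eqxx msupp1 inE => /eqP ->.
  by rewrite mdeg0.
- by exists 1%:M; rewrite mulmx1 mxE eqxx subrr.
- move=> v; rewrite mulmx1 [X in _ <-> exists _, X = _]mx11_scalar.
  exact: ex0.
- move=> [|[|[|i]]] v //=.
    split=> [/ex3 ->|[u ->]]; first by exists 0; rewrite mul0mx.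
    by rewrite mulmx0 mul0mx.
  by split=> _; [exists 0; apply/matrixP => ? [] | rewrite mulmx0].
Qed.

End Resolutions.

(** * Dimensions of graded pieces *)

Section Dimensions.

Variable k : fieldType.
Local Notation R := (poly3 k).

(** The degree d part of R^n, encoded as a finite-dimensional vector space so that rank-nullity
    applies; [rowof] and [hrow_of] pass to and from rows of polynomials. *)
Definition hrow (n d : nat) := {ffun 'I_n -> dhomog 3 k d}.

Definition rowof n d (v : hrow n d) : 'rV[R]_n := \row_i val (v i).

(** Entries that are not homogeneous of degree d are sent to the default 0; [hrow_ofK] covers the
    intended case. *)
Definition hrow_of n d (v : 'rV[R]_n) : hrow n d :=
  [ffun i => insubd (0 : dhomog 3 k d) (v 0 i)].

Lemma dim_hrow n d : \dim {: hrow n d} = (n * 'C(d.+2, 2))%N.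
Proof.
rewrite dimvf -[in RHS](card_ord n).
have -> : 'C(d.+2, 2) = 'C(d + 2, d); last by [].
by rewrite addn2 -bin_sub // !subSS subn0.
Qed.

Lemma rowof_inj n d : injective (@rowof n d).
Proof.
move=> u v /rowP e; apply/ffunP => i; apply/val_inj.
by have := e i; rewrite !mxE.
Qed.

Lemma rowofZD n d (c : k) (u v : hrow n d) :
  rowof (c *: u + v) = c%:MP *: rowof u + rowof v.
Proof. by apply/rowP => i; rewrite !mxE !ffunE /= mul_mpolyC. Qed.

Lemma rowof0 n d : rowof (0 : hrow n d) = 0.
Proof. by apply/rowP => i; rewrite !mxE ffunE. Qed.

Lemma rowof_sum n d N (c : 'I_N -> k) (u : 'I_N -> hrow n d) :
  rowof (\sum_i c i *: u i) = \sum_i (c i)%:MP *: rowof (u i).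
Proof.
elim/big_rec2: _ => [|i x y _ <-]; [exact: rowof0 | exact: rowofZD].
Qed.

Lemma rowof_homog n d (v : hrow n d) i : rowof v 0 i \is d.-homog.
Proof. by rewrite mxE; exact: dhomog_is_dhomog. Qed.

Lemma hrow_ofK n d (v : 'rV[R]_n) :
  (forall i, v 0 i \is d.-homog) -> rowof (hrow_of d v) = v.
Proof.
by move=> hv; apply/rowP => i; rewrite mxE ffunE insubdK //; exact: hv.
Qed.

Lemma homog_mulmx m n d q (u : 'rV[R]_n) (A : 'M[R]_(n, m)) i :
  (forall i, u 0 i \is d.-homog) -> (forall a b, A a b \is q.-homog) ->
  (u *m A) 0 i \is (d + q).-homog.
Proof.
by move=> hu hA; rewrite mxE rpred_sum // => j _; apply: dhomogM.
Qed.

Lemma mulrow_ex m n d q (A : 'M[R]_(n, m)) :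
  (forall a b, A a b \is q.-homog) ->
  exists f : 'Hom(hrow n d, hrow m (d + q)),
    forall v, rowof (f v) = rowof v *m A.
Proof.
move=> hA; pose g (v : hrow n d) := hrow_of (d + q) (rowof v *m A).
have gE v : rowof (g v) = rowof v *m A.
  by rewrite hrow_ofK // => i; apply: homog_mulmx => // j; exact: rowof_homog.
have lin : linear g.
  move=> c u v; apply: rowof_inj.
  apply: (etrans (gE _)); apply: (etrans _ (esym (rowofZD c (g u) (g v)))).
  rewrite (rowofZD c u v) mulmxDl -scalemxAl.
  exact: (congr2 (fun x y => c%:MP *: x + y) (esym (gE u)) (esym (gE v))).
pose gL : {linear _ -> _} := HB.pack g (GRing.isLinear.Build _ _ _ _ g lin).
by exists (linfun gL) => v; rewrite lfunE /= gE.
Qed.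

(* The graded pieces of J, encoded as spaces of rows of length 1. *)
Definition is_piece (J : {pred R}) d (U : {vspace hrow 1 d}) :=
  forall u, (u \in U) = (rowof u 0 0 \in J).

Lemma ideal_sum (J : {pred R}) N (c p : 'I_N -> R) :
  idealr_closed J -> (forall i, p i \in J) -> \sum_i c i * p i \in J.
Proof.
move=> [J0 _ JD] hp; elim/big_rec: _ => // i x _ hx; exact: JD.
Qed.

(** Expanding a basis of R_d in the given basis of the quotient, modulo J, and extending linearly
    gives a map R_d -> k^h. It is onto with kernel J_d, so rank-nullity gives the dimension. *)
Lemma quot_piece_vspace (J : {pred R}) d h :
  idealr_closed J -> quot_piece_dim J d h ->
  exists2 U : {vspace hrow 1 d}, is_piece J U & (\dim U + h = 'C(d.+2, 2))%N.
Proof.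
move=> idJ [b [bh indep gen]]; have [J0 _ JD] := idJ.
have JB p q : p \in J -> q \in J -> p - q \in J.
  by move=> hp hq; rewrite addrC -mulN1r; apply: JD.
have JA p q : p \in J -> q \in J -> p + q \in J.
  by move=> hp hq; rewrite -[p]mul1r; apply: JD.
pose N := \dim {: hrow 1 d}; pose e := vbasis {: hrow 1 d}.
have ex (l : 'I_N) : exists c : 'I_h -> k,
    rowof e`_l 0 0 - \sum_i c i *: b i \in J.
  exact/gen/rowof_homog.
have [c hc] := fin_all_exists ex.
pose g (v : hrow 1 d) : 'rV[k]_h := \row_i \sum_l coord e l v * c l i.
have lin : linear g.
  move=> a u v; apply/rowP => i; rewrite !mxE mulr_sumr -big_split /=.
  by apply: eq_bigr => l _; rewrite linearP mulrDl mulrA.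
pose gL : {linear _ -> _} := HB.pack g (GRing.isLinear.Build _ _ _ _ g lin).
have gE v : rowof v 0 0 - \sum_i g v 0 i *: b i \in J.
  have -> : rowof v 0 0 - \sum_i g v 0 i *: b i =
      \sum_l (coord e l v)%:MP * (rowof e`_l 0 0 - \sum_i c l i *: b i).
    rewrite {1}(coord_vbasis (memvf v)) rowof_sum summxE.
    under [in LHS]eq_bigr => l _ do rewrite mxE.
    under [RHS]eq_bigr => l _ do rewrite mulrBr.
    rewrite sumrB; congr (_ - _).
    under [RHS]eq_bigr => l _ do rewrite mulr_sumr.
    rewrite exchange_big; apply: eq_bigr => i _ /=.
    rewrite mxE scaler_suml; apply: eq_bigr => l _.
    by rewrite mul_mpolyC scalerA.
  exact: ideal_sum.
have gL0 v : (v \in lker (linfun gL)) = (rowof v 0 0 \in J).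
  rewrite memv_ker lfunE /=; apply/eqP/idP => [g0|vJ].
    by have := gE v; rewrite g0 big1 ?subr0 // => i _; rewrite mxE scale0r.
  apply/rowP => i; rewrite [RHS]mxE; apply: (indep (fun i => g v 0 i)).
  by rewrite -[X in X \in J](subKr (rowof v 0 0)); apply: JB.
exists (lker (linfun gL)); first exact: gL0.
rewrite -[RHS]mul1n -dim_hrow -(limg_ker_dim (linfun gL) fullv) capfv.
congr (_ + _)%N; suff -> : limg (linfun gL) = fullv.
  by rewrite dimvf dim_matrix; exact/esym/mul1n.
apply/vspaceP => w; rewrite memvf; apply/memv_imgP.
exists (hrow_of d (\row__ (\sum_i w 0 i *: b i))); first exact: memvf.
rewrite lfunE /=; set v := hrow_of _ _.
have vE : rowof v 0 0 = \sum_i w 0 i *: b i.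
  rewrite hrow_ofK ?mxE // => i; rewrite mxE; apply: rpred_sum => j _.
  by apply: dhomogZ; exact: bh.
apply/rowP => i; apply/eqP; rewrite -subr_eq0 -opprB oppr_eq0; apply/eqP.
apply: (indep (fun i => g v 0 i - w 0 i)).
have := gE v; rewrite vE -opprB => /(JB _ _ J0); rewrite sub0r opprK -sumrB.
under eq_bigr => l _ do rewrite -scalerBl.
by [].
Qed.

(** Write the first family in terms of the second modulo W, with coefficient matrix [C]. A row
    vector killed by [C] gives a combination of the first family lying in W, hence is zero; so [C]
    has rank m, at most n. *)
Lemma subquot_dim_le (V : lmodType k) (U W : V -> Prop) m n :
  W 0 -> (forall c u v, W u -> W v -> W (c *: u + v)) ->
  subquot_dim U W m -> subquot_dim U W n -> (m <= n)%N.
Proof.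
move=> W0 WD [b [bU indep _]] [b' [_ _ gen]].
have Wsum N (c : 'I_N -> k) (u : 'I_N -> V) :
    (forall i, W (u i)) -> W (\sum_i c i *: u i).
  by move=> hu; elim/big_rec: _ => // i x _; apply: WD.
have [c hc] := fin_all_exists (fun i => gen _ (bU i)).
pose C := \matrix_(i < m, j < n) c i j.
suff /eqP <- : row_free C by exact: rank_leq_col.
apply/inj_row_free => v vC; apply/rowP => i; rewrite mxE.
apply: (indep (fun i => v 0 i)).
have -> : \sum_i v 0 i *: b i = \sum_i v 0 i *: (b i - \sum_j c i j *: b' j).
  under [RHS]eq_bigr => l _ do rewrite scalerBr scaler_sumr.
  rewrite sumrB exchange_big /= [X in _ - X]big1 ?subr0 // => j _.
  under eq_bigr => l _ do rewrite scalerA.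
  rewrite -scaler_suml; have /rowP/(_ j) := vC; rewrite !mxE.
  by under eq_bigr => l _ do rewrite mxE; move=> ->; rewrite scale0r.
exact: Wsum.
Qed.

Lemma subquot_dim_uniq (V : lmodType k) (U W : V -> Prop) m n :
  W 0 -> (forall c u v, W u -> W v -> W (c *: u + v)) ->
  subquot_dim U W m -> subquot_dim U W n -> m = n.
Proof.
move=> W0 WD hm hn; apply/eqP; rewrite eqn_leq.
by rewrite (subquot_dim_le W0 WD hm hn) (subquot_dim_le W0 WD hn hm).
Qed.

Lemma ker_mulrow m n d q (A : 'M[R]_(n, m)) (U : {vspace hrow m (d + q)}) :
  (forall a b, A a b \is q.-homog) ->
  (forall u, u \in U <-> exists v : 'rV_n, rowof u = v *m A) ->
  exists2 K : {vspace hrow n d},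
    forall v, v \in K <-> rowof v *m A = 0
  & (\dim K + \dim U = n * 'C(d.+2, 2))%N.
Proof.
move=> hA hU; have [f fE] := mulrow_ex d hA.
exists (lker f) => [v|].
  rewrite memv_ker -fE; split=> [/eqP ->|z]; first exact: rowof0.
  by apply/eqP/rowof_inj; rewrite z rowof0.
rewrite -dim_hrow -(limg_ker_dim f fullv) capfv; congr (_ + \dim _)%N.
apply/vspaceP => u; apply/idP/memv_imgP => [/hU [v uv]|[v _ ->]]; last first.
  by apply/hU; exists (rowof v); rewrite fE.
(* The preimage v of u may be inhomogeneous; its component of entry degree d has the same image. *)
pose z n := fun _ : 'I_n => 0%N.
have hAz : homogmx (fun=> q) (z m) A.
  by apply: dhomog_homogmx => a b; left; rewrite subn0.
exists (hrow_of d (hcomp (fun=> (d + q)%N) (fun=> q) v)); first exact: memvf.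
apply: rowof_inj; rewrite fE hrow_ofK => [|i]; last first.
  have := homogmx_dhomog 0 i (homogmx_hcomp (fun=> (d + q)%N) (fun=> q) v).
  by rewrite addnK.
rewrite -(hcompM _ _ hAz) -uv hcomp_id //.
by apply: dhomog_homogmx => a b; left; rewrite subn0 ord1 rowof_homog.
Qed.

End Dimensions.

(** * Syzygies of J *)

Lemma bin2_double m : ('C(m, 2) * 2 = m * m.-1)%N.
Proof. by have := mul_bin_diag m 1; rewrite bin1; lia. Qed.

(** Here a is the dimension of the degree d part of ker Q, b that of the syzygies of f with entries
    of degree d + 2, and C(d+2-s, 2) that of R in degree d - s. Doubling turns the binomials into
    polynomials, and the split at d = s resolves the truncated subtractions. *)
Lemma hilbert_ker s d a b : 
  (a + b = s.+1 * 'C(d.+2, 2))%N ->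
  (b + 'C(d + s + 4, 2) = s.+1 * 'C(d.+4, 2) + 'C(2 * s + 1 - (d + 2 + s), 2))%N ->
  a = 'C(d.+2 - s, 2).
Proof.
move=> h1 h2.
have e1 : (s.+1 * 'C(d.+2, 2) * 2 = s.+1 * (d.+2 * d.+1))%N by rewrite -mulnA bin2_double.
have e2 : (s.+1 * 'C(d.+4, 2) * 2 = s.+1 * (d.+4 * d.+3))%N by rewrite -mulnA bin2_double.
have e3 := bin2_double (d + s + 4).
have e4 := bin2_double (2 * s + 1 - (d + 2 + s)).
have e5 := bin2_double (d.+2 - s).
rewrite [in X in _ = (_ * X)%N]addnC /= in e3.
move: h1 h2 e1 e2 e3 e4 e5.
move: (s.+1 * 'C(d.+2, 2))%N (s.+1 * 'C(d.+4, 2))%N 'C(d + s + 4, 2) 'C(2 * s + 1 - (d + 2 + s), 2) 'C(d.+2 - s, 2) => A B C D E.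
have [lt|ge] := ltnP d s.
  have [t ->] : exists t, s = (d + 1 + t)%N by exists (s - (d + 1))%N; lia.
  have -> : (2 * (d + 1 + t) + 1 - (d + 2 + (d + 1 + t)))%N = t by lia.
  case: t => [|t] /=; first by nia.
  have -> : (d.+2 - (d + 1 + t.+1) = 0)%N by lia.
  nia.
have [t ->] : exists t, d = (s + t)%N by exists (d - s)%N; lia.
have -> : (2 * s + 1 - (s + t + 2 + s) = 0)%N by lia.
have -> : ((s + t).+2 - s = t.+2)%N by lia.
nia.
Qed.

Section Presentation.

Variables (k : fieldType) (s : nat).
Local Notation R := (poly3 k).
Local Notation n := (s.+1).

Variables (J : {pred R}) (f : 'cV[R]_n).
Hypotheses (f_homog : forall i, f i 0 \is s.-homog)
  (genJ : forall p, p \in J <-> exists v, p%:M = v *m f)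
  (dimJ : forall d, (s <= d)%N ->
     exists2 U : {vspace hrow k 1 d},
       is_piece J U & (\dim U + 'C(2 * s + 1 - d, 2) = 'C(d.+2, 2))%N).

(** Rank-nullity for the surjection given by [f] onto J in degree d + s, where R/J has dimension
    C(2s+1-(d+s), 2). *)
Lemma syzygy_piece d :
  exists2 K : {vspace hrow k n d},
    forall v, v \in K <-> rowof v *m f = 0
  & (\dim K + 'C(d + s + 2, 2) =
       n * 'C(d.+2, 2) + 'C(2 * s + 1 - (d + s), 2))%N.
Proof.
have [U hU dimU] := dimJ (leq_addl d s).
have [|u|K hK dimK] := @ker_mulrow k 1 n d s f U.
- by move=> a b; rewrite ord1.
- rewrite hU; split=> [/genJ [v hv]|[v hv]].
    by exists v; rewrite -hv -mx11_scalar.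
  by apply/genJ; exists v; rewrite -hv -mx11_scalar.
- by exists K => //; rewrite addn2; lia.
Qed.

(** The count is 6(s+1) + C(s-1, 2) - C(s+4, 2) = s + 1: there are as many independent quadratic
    syzygies as generators, so [Q] can be square. *)
Lemma quadratic_syzygies : (0 < s)%N ->
  exists Q : 'M[R]_n,
    [/\ forall i j, Q i j \is 2.-homog, Q *m f = 0
      & forall v : 'rV[R]_n, (forall i, v 0 i \is 2.-homog) -> v *m f = 0 ->
        exists u, v = u *m Q].
Proof.
move=> s0; have [K hK dimK] := syzygy_piece 2.
have {}dimK : \dim K = n.
  move: dimK (bin2_double (2 + s + 2)) (bin2_double 4).
  move: (bin2_double (2 * s + 1 - (2 + s))).
  nia.
have [Q [hQ Q0 genQ]] : exists Q : 'M[R]_(\dim K, n),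
    [/\ forall i j, Q i j \is 2.-homog, Q *m f = 0
      & forall v : 'rV[R]_n, (forall i, v 0 i \is 2.-homog) -> v *m f = 0 ->
        exists u, v = u *m Q].
  exists (\matrix_i rowof (vbasis K)`_i); split.
  - by move=> i j; rewrite mxE rowof_homog.
  - apply/row_matrixP => i; rewrite row_mul rowK row0; apply/hK.
    by apply/vbasis_mem/mem_nth; rewrite size_tuple.
  - move=> v hv v0; have vK : hrow_of 2 v \in K by apply/hK; rewrite hrow_ofK.
    exists (\row_i (coord (vbasis K) i (hrow_of 2 v))%:MP).
    rewrite -{1}(hrow_ofK hv) {1}(coord_vbasis vK) rowof_sum mulmx_sum_row.
    by apply: eq_bigr => i _; rewrite rowK mxE.
by move: Q hQ Q0 genQ; rewrite dimK => Q; exists Q.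
Qed.

(* The kernel of Q has, by rank-nullity in every degree, the Hilbert function of
   R(-s), so a nonzero element of degree s generates it. *)
Lemma second_syzygies (Q : 'M[R]_n) :
  (forall i j, Q i j \is 2.-homog) -> Q *m f = 0 ->
  (forall v : 'rV[R]_n, v *m f = 0 -> exists u, v = u *m Q) ->
  exists w : 'rV[R]_n,
    [/\ forall i, w 0 i \is s.-homog, w != 0, w *m Q = 0
      & forall v : 'rV[R]_n, v *m Q = 0 -> exists r, v = r *: w].
Proof.
move=> hQ Q0 genQ.
have ker d : exists2 K : {vspace hrow k n d},
    forall v, v \in K <-> rowof v *m Q = 0
  & (\dim K = 'C(d.+2 - s, 2))%N.
  have [V hV dimV] := syzygy_piece (d + 2).
  have [|u|K hK dimK] := @ker_mulrow k n n d 2 Q V => //.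
    rewrite hV; split=> [/genQ //|[v ->]].
    by rewrite -mulmxA Q0 mulmx0.
  exists K => //.
  apply: hilbert_ker dimK _.
  have e1 : (d + 2 + s + 2 = d + s + 4)%N by lia.
  have e2 : ((d + 2).+2 = d.+4)%N by lia.
  by rewrite -e1 -e2.
have [K hK dimK] := ker s.
have [w [ws wn0 w0]] : exists w : hrow k n s,
    [/\ w \in K, w != 0 & rowof w *m Q = 0].
  exists (vpick K); split; first exact: memv_pick.
    by rewrite vpick0 -dimv_eq0 dimK -addn2 addKn.
  by apply/hK; exact: memv_pick.
exists (rowof w); split=> [i|||v v0]; first exact: rowof_homog.
- by apply: contra_neq wn0 => z; apply: rowof_inj; rewrite z rowof0.
- exact: w0.
(* R is a domain, so multiplication by [w] is injective from R in degree d - s; the target has the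
   same dimension, so it is onto. *)
have zw d (v' : 'rV[R]_n) : (forall i, v' 0 i \is d.-homog) -> (s <= d)%N ->
    v' *m Q = 0 -> exists r, v' = r *: rowof w.
  move=> hv' le v'0; pose e := (d - s)%N.
  rewrite -(subnK le) -/e in hv'.
  have [Ke hKe dimKe] := ker (e + s)%N.
  have [g hg] := @mulrow_ex k n 1 e s (rowof w) (fun a b =>
    eq_ind_r (fun a => rowof w a b \is s.-homog) (rowof_homog w b) (ord1 a)).
  have gK : (limg g <= Ke)%VS.
    apply/subvP => _ /memv_imgP [u _ ->]; apply/hKe.
    by rewrite hg -mulmxA w0 mulmx0.
  have kerg : (fullv :&: lker g)%VS = 0%VS.
    apply/eqP; rewrite capfv -subv0; apply/subvP => u.
    rewrite memv_ker memv0 => /eqP gu; apply/eqP/rowof_inj/rowP => i.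
    have := hg u; rewrite gu rowof0 => /esym/matrixP uw.
    rewrite ord1 rowof0 [RHS]mxE; apply/eqP; apply: contraT => nz.
    case/negP: wn0; apply/eqP/rowof_inj/rowP => j; rewrite rowof0 [RHS]mxE.
    have /eqP := uw 0 j; rewrite [X in X == _]mxE [X in _ == X]mxE big_ord1.
    by rewrite mulf_eq0 (negPf nz) => /eqP.
  have eqK : limg g = Ke.
    apply/eqP; rewrite eqEdim gK (limg_dim_eq kerg) dim_hrow dimKe mul1n.
    have -> : ((e + s).+2 - s = e.+2)%N by lia. exact: leqnn.
  have /memv_imgP [u _ vu] : hrow_of (e + s) v' \in limg g.
    by rewrite eqK; apply/hKe; rewrite hrow_ofK.
  exists (rowof u 0 0); rewrite -(hrow_ofK hv') vu hg; apply/rowP => j.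
  by rewrite !mxE big_ord1 !mxE.
have hQz : homogmx (fun=> 2%N) (fun=> 0%N) Q.
  by apply: dhomog_homogmx => a b; left; rewrite subn0.
(* With shift 2 on every coordinate, component j has entries of degree j - 2, and it is zero for j <
   2. *)
pose c := fun _ : 'I_n => 2%N.
have [N ->] := sum_hcomp c v.
suff ex (j : 'I_N) : exists r, hcomp (fun=> val j) c v = r *: rowof w.
  have [r hr] := fin_all_exists ex; exists (\sum_j r j).
  by rewrite scaler_suml; apply: eq_bigr => j _.
have hj i : hcomp (fun=> val j) c v 0 i \is (val j - 2).-homog.
  exact: (homogmx_dhomog 0 i (homogmx_hcomp (fun=> val j) c v)).
have j0 : hcomp (fun=> val j) c v *m Q = 0.
  by rewrite -(hcompM _ _ hQz) v0 hcomp0.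
have [lt|ge] := ltnP (val j - 2) s; last exact: zw hj ge j0.
(* Below degree s the kernel is zero, because C(d+2-s, 2) vanishes. *)
have [Kj hKj dimKj] := ker (val j - 2)%N.
exists 0; rewrite scale0r -(hrow_ofK hj).
have : hrow_of (val j - 2) (hcomp (fun=> val j) c v) \in Kj.
  by apply/hKj; rewrite hrow_ofK.
have /eqP -> : Kj == 0%VS by rewrite -dimv_eq0 dimKj bin_small //; lia.
by rewrite memv0 => /eqP ->; rewrite rowof0.
Qed.

End Presentation.

(** * The Koszul complex in three variables *)

Section Koszul.

Variable k : fieldType.
Local Notation R := (poly3 k).

(** A left inverse of multiplication by x_a that drops the terms free of x_a and commutes with the
    other variables. It makes the regularity of the sequence of variables effective. The filter
    excludes exponents where the monomial subtraction would truncate. *)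
Definition divX (a : 'I_3) (p : R) : R :=
  \sum_(m <- msupp p | m a != 0%N) p@_m *: 'X_[m - U_(a)].

Lemma mcoeff_divX a p m : (divX a p)@_m = p@_(m + U_(a)).
Proof.
have eqm (m' : 'X_{1..3}) : m' a != 0%N ->
    ('X_[m' - U_(a)] : R)@_m = (m' == (m + U_(a))%MM)%:R.
  move=> nz; rewrite mcoeffX; congr (_%:R); congr (nat_of_bool _).
  have le : (U_(a) <= m')%MM.
    by apply/mnm_lepP => i; rewrite mnm1E; case: eqP => // <-; rewrite lt0n.
  by apply/eqP/eqP => [<-|->]; rewrite ?submK ?addmK.
have nz : (m + U_(a))%MM a != 0%N by rewrite mnmDE mnm1E eqxx addn1.
rewrite /divX raddf_sum /=.
have [in_p|out_p] := boolP ((m + U_(a))%MM \in msupp p); last first.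
  rewrite (memN_msupp_eq0 out_p) big_seq_cond big1 // => m' /andP[m'p m'a].
  rewrite mcoeffZ eqm //; case: eqP => [eqm'|_]; last by rewrite mulr0.
  by rewrite -eqm' m'p in out_p.
rewrite big_mkcond (bigD1_seq _ in_p (msupp_uniq p)) /= nz mcoeffZ eqm // eqxx mulr1.
rewrite big1 ?addr0 // => m' ne; case: ifP => // m'a.
by rewrite mcoeffZ eqm // (negPf ne) mulr0.
Qed.

Lemma divXD a p q : divX a (p + q) = divX a p + divX a q.
Proof. by apply/mpolyP => m; rewrite mcoeffD !mcoeff_divX mcoeffD. Qed.

Lemma divXN a p : divX a (- p) = - divX a p.
Proof. by apply/mpolyP => m; rewrite mcoeffN !mcoeff_divX mcoeffN. Qed.

Lemma divXK a p : divX a ('X_a * p) = p.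
Proof. by apply/mpolyP => m; rewrite mcoeff_divX mulrC addmC mcoeffMX. Qed.

Lemma divXM a b p : a != b -> divX a ('X_b * p) = 'X_b * divX a p.
Proof.
move=> ne; elim/mpolyind: p => [|c m p _ _ IH].
  by apply/mpolyP => m; rewrite mulr0 mcoeff_divX mcoeff0 mcoeffM big1 // => i _;
     rewrite mcoeff_divX mcoeff0 mulr0.
rewrite mulrDr !divXD IH mulrDr; congr (_ + _).
have divZ q : divX a (c *: q) = c *: divX a q.
  by apply/mpolyP => l; rewrite mcoeffZ !mcoeff_divX mcoeffZ.
rewrite -scalerAr !divZ -scalerAr -mpolyXD; congr (_ *: _).
rewrite /divX !msuppX !(big_mkcond (fun _ => _ != _)) !big_seq1 /= !mcoeffX !eqxx !scale1r.
rewrite mnmDE mnm1E [b == a]eq_sym (negPf ne) add0n; case: ifP => [ma|_]; last by rewrite mulr0.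
rewrite -mpolyXD; congr ('X_[_]); apply/mnmP => i.
rewrite !(mnmBE, mnmDE, mnm1E).
case: (eqVneq a i) ma => [<-|_] ma /=; last by rewrite !subn0.
by rewrite [b == a]eq_sym (negPf ne) !add0n.
Qed.

Lemma divX0 a : divX a 0 = 0.
Proof. by apply/mpolyP => m; rewrite mcoeff_divX !mcoeff0. Qed.

Local Notation o0 := (@Ordinal 3 0 isT).
Local Notation o1 := (@Ordinal 3 1 isT).
Local Notation o2 := (@Ordinal 3 2 isT).

Lemma sum3 (V : nmodType) (F : 'I_3 -> V) : \sum_i F i = F o0 + F o1 + F o2.
Proof.
rewrite !big_ord_recl big_ord0 addr0 addrA.
by congr (F _ + F _ + F _); apply: val_inj.
Qed.

Lemma eq_row3 (u v : 'rV[R]_3) :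
  u 0 o0 = v 0 o0 -> u 0 o1 = v 0 o1 -> u 0 o2 = v 0 o2 -> u = v.
Proof.
move=> e0 e1 e2; apply/rowP => -[[|[|[|i]]] lt] //.
- by rewrite (_ : Ordinal lt = o0) //; apply: val_inj.
- by rewrite (_ : Ordinal lt = o1) //; apply: val_inj.
- by rewrite (_ : Ordinal lt = o2) //; apply: val_inj.
Qed.

Definition vars : 'cV[R]_3 := \col_a 'X_a.

Local Notation x0 := ('X_o0 : R).
Local Notation x1 := ('X_o1 : R).
Local Notation x2 := ('X_o2 : R).

Definition koszul2 : 'M[R]_3 :=
  \matrix_(i, j) (nth [::] [:: [:: - x1; x0; 0]; [:: - x2; 0; x0];
                               [:: 0; - x2; x1]] i)`_j.

Definition koszul3 : 'rV[R]_3 := \row_i [:: x2; - x1; x0]`_i.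

Lemma koszul2_vars : koszul2 *m vars = 0.
Proof.
apply/colP => -[[|[|[|i]]] lt] //; rewrite !mxE sum3 !mxE /=; ring.
Qed.

Lemma koszul32 : koszul3 *m koszul2 = 0.
Proof. by apply: eq_row3; rewrite !mxE sum3 !mxE /=; ring. Qed.

(** Dividing the relation by x0 expresses a through the quotients of b and c. The x0-free remainders
    p, q of b and c satisfy x1 p + x2 q = 0; dividing this by x1 gives p, and cancelling x2 gives q.
    The three quotients are the coefficients sought. *)
Lemma koszul2_exact (v : 'rV[R]_3) : v *m vars = 0 -> exists u, v = u *m koszul2.
Proof.
move/rowP/(_ 0); rewrite !mxE sum3 !mxE.
set a := v 0 o0; set b := v 0 o1; set c := v 0 o2 => e.
have {}e : x0 * a + x1 * b + x2 * c = 0 by rewrite -e; ring.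
have e0 : a + x1 * divX o0 b + x2 * divX o0 c = 0.
  by rewrite -(divX0 o0) -e !divXD divXK !divXM.
have [p def_p] : exists p, p = b - x0 * divX o0 b by eexists.
have [q def_q] : exists q, q = c - x0 * divX o0 c by eexists.
have epq : x1 * p + x2 * q = 0.
  transitivity (x0 * a + x1 * b + x2 * c
                - x0 * (a + x1 * divX o0 b + x2 * divX o0 c)).
    by rewrite def_p def_q; ring.
  by rewrite e e0; ring.
have e1 : p + x2 * divX o1 q = 0.
  by rewrite -(divX0 o1) -epq divXD divXK divXM.
have e2 : q - x1 * divX o1 q = 0.
  rewrite -[LHS](divXK o2) -(divX0 o2); congr divX.
  transitivity (x1 * p + x2 * q - x1 * (p + x2 * divX o1 q)); first by ring.
  by rewrite epq e1; ring.
exists (\row_i [:: divX o0 b; divX o0 c; divX o1 q]`_i).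
apply: eq_row3; rewrite !mxE sum3 !mxE /= -[LHS]subr0.
- by rewrite -[X in _ - X]e0 -/a; ring.
- by rewrite -[X in _ - X]e1 -/b def_p; ring.
- by rewrite -[X in _ - X]e2 -/c {1}def_q; ring.
Qed.

(** The quotient of c by x0 is the multiplier: division by x0 yields the other two entries, and
    cancelling x2 shows that c is divisible by x0. *)
Lemma koszul3_exact (u : 'rV[R]_3) :
  u *m koszul2 = 0 -> exists r, u = r *: koszul3.
Proof.
move/rowP=> e; move: (e o0) (e o1) (e o2); rewrite !mxE !sum3 !mxE /= => {e}.
set a := u 0 o0; set b := u 0 o1; set c := u 0 o2 => e0 e1 e2.
have {}e1 : x0 * a = x2 * c by apply/eqP; rewrite -subr_eq0 -e1; apply/eqP; ring.
have {}e2 : x0 * b = - (x1 * c).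
  by apply/eqP; rewrite -addr_eq0 -e2; apply/eqP; ring.
have ea : a = x2 * divX o0 c by rewrite -[LHS](divXK o0) e1 divXM.
have eb : b = - (x1 * divX o0 c) by rewrite -[LHS](divXK o0) e2 divXN divXM.
have ec : c = x0 * divX o0 c.
  rewrite -[LHS](divXK o2) -[RHS](divXK o2); congr divX.
  by rewrite -e1 {1}ea; ring.
exists (divX o0 c); apply: eq_row3; rewrite !mxE /=.
- by rewrite -/a ea; ring.
- by rewrite -/b eb; ring.
- by rewrite -/c {1}ec; ring.
Qed.

Lemma vars_homog : homogmx (fun=> 1%N) (fun=> 0%N) vars.
Proof.
apply: dhomog_homogmx => a b; left; split=> //.
by rewrite mxE dhomogX /= mdeg1.
Qed.

Lemma koszul2_homog a b : koszul2 a b \is 1.-homog.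
Proof.
have hX (i : 'I_3) : ('X_i : R) \is 1.-homog by rewrite dhomogX /= mdeg1.
rewrite mxE; case: a => -[|[|[|a]]] lta //=; case: b => -[|[|[|b]]] ltb //=;
  rewrite ?dhomogN ?hX ?dhomog0 //; exact: dhomog0.
Qed.

Lemma koszul3_homog a b : koszul3 a b \is 1.-homog.
Proof.
have hX (i : 'I_3) : ('X_i : R) \is 1.-homog by rewrite dhomogX /= mdeg1.
by rewrite mxE; case: b => -[|[|[|b]]] ltb //=; rewrite ?dhomogN ?hX.
Qed.

End Koszul.

(** * The mapping cone *)

Section MappingCone.

Variables (k : fieldType) (s : nat).
Local Notation R := (poly3 k).

Variables (f0 : 'M[R]_1) (f' : 'cV[R]_s).
Variables (Q : 'M[R]_(1 + s)) (w : 'rV[R]_(1 + s)).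
Local Notation f := (col_mx f0 f').
Hypotheses (s_gt0 : (0 < s)%N)
  (f_homog : forall i, f i 0 \is s.-homog)
  (Q_homog : forall i j, Q i j \is 2.-homog)
  (w_homog : forall i, w 0 i \is s.-homog)
  (w_neq0 : w != 0)
  (Qf : Q *m f = 0) (wQ : w *m Q = 0)
  (exQ : forall v : 'rV[R]_(1 + s), v *m f = 0 -> exists u, v = u *m Q)
  (exw : forall v : 'rV[R]_(1 + s), v *m Q = 0 -> exists r, v = r *: w).

(* f0 is the generator of J that is lost in I = (f') + m f0, and Q, w resolve
   J = (f0, f'). *)
Lemma socle_extension_resolution (I : {pred R}) :
  0 \in I ->
  (forall p, p \in I <-> exists v, p%:M = v *m col_mx f' (vars k *m f0)) ->
  exists F : gfree k,
    [/\ resolves F I, minimal F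
      & shifts F = shifts3 (nseq s s ++ nseq 3 (s + 1)%N) (nseq (s + 4)%N (s + 2)%N)
                           [:: 2 * s + 2; s + 3]%N].
Proof.
move=> I0 genI.
pose q0 : 'cV_(1 + s) := lsubmx Q; pose Q' : 'M_(1 + s, s) := rsubmx Q.
have QE : Q = row_mx q0 Q' by rewrite hsubmxK.
(* The map J -> J/I = k(-s) lifts to complexes: first the projection to the coordinate of f0, then
   [L], which exists because the quadrics in [q0] lie in the ideal of the variables. *)
have [L hL LE] : exists2 L : 'M[R]_(1 + s, 3),
    homogmx (fun=> 2%N) (fun=> 1%N) L & L *m vars k = q0.
  have hq : homogmx (fun=> 2%N) (fun=> 0%N) q0.
    by apply: dhomog_homogmx => a b; left; rewrite mxE subn0.
  have [|B hB] := @mx_maxl k _ _ q0; first exact: mcoeff0_eq0 hq _.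
  exists (hcomp (fun=> 2%N) (fun=> 1%N) (\matrix_(i, a) B a i 0)).
    exact: homogmx_hcomp.
  rewrite -(hcompM _ _ (@vars_homog k)) -[RHS](hcomp_id hq) hB; congr hcomp.
  apply/colP => i; rewrite mxE summxE; apply: eq_bigr => a _.
  by rewrite !mxE mulrC.
have vf (a : 'M_1) (b : 'rV[R]_s) : row_mx a b *m f = a *m f0 + b *m f'.
  by rewrite mul_row_col.
have vQ (p : 'rV[R]_(1 + s)) : p *m Q = row_mx (p *m q0) (p *m Q').
  by rewrite QE mul_mx_row.
have Qf' : q0 *m f0 + Q' *m f' = 0 by rewrite -mul_row_col -QE.
have wq0 : w *m q0 = 0 by move: wQ; rewrite vQ => /eqP; rewrite row_mx_eq0 => /andP[/eqP].
have wQ' : w *m Q' = 0 by move: wQ; rewrite vQ => /eqP; rewrite row_mx_eq0 => /andP[_ /eqP].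
pose K2 := koszul2 k; pose K3 := koszul3 k.
have hK2 : homogmx (fun=> 1%N) (fun=> 0%N) K2.
  by apply: dhomog_homogmx => a b; left; rewrite subn0; split=> //; exact: koszul2_homog.
have hwL : homogmx (fun=> (s + 1)%N) (fun=> 0%N) (w *m L).
  apply: (@homogmxM _ _ _ _ _ (fun=> 1%N)); apply: dhomog_homogmx => a b; left.
    by rewrite leq_addl addnK ord1.
  by rewrite subn0; split=> //; exact: (homogmx_dhomog a b hL).
(* Next stage of the lift: [w *m L] is a Koszul cycle because w q0 = 0. The sign makes the composite
   [D2 *m D1] vanish. *)
have [c0 hc0 c0E] : exists2 c0 : 'rV[R]_3,
    homogmx (fun=> (s + 1)%N) (fun=> 1%N) c0 & w *m L = - (c0 *m K2).
  have [|c hc] := @koszul2_exact k (w *m L); first by rewrite -mulmxA LE.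
  exists (- hcomp (fun=> (s + 1)%N) (fun=> 1%N) c).
    by rewrite -hcompN; exact: homogmx_hcomp.
  by rewrite mulNmx opprK -(hcompM _ _ hK2) -hc hcomp_id.
have K3_neq0 (r : R) : r *: K3 = 0 -> r = 0.
  move/rowP/(_ 0); rewrite !mxE /= => /eqP; rewrite mulf_eq0 => /orP[/eqP //|].
  by rewrite -msupp_eq0 msuppX.
have w_tors (r : R) : r *: w = 0 -> r = 0.
  move=> rw; apply: contraNeq w_neq0 => nz; apply/eqP/rowP => i.
  have /rowP/(_ i)/eqP := rw.
  by rewrite !mxE mulf_eq0 (negPf nz) /= => /eqP.
(* The cone after cancelling f0 against the generator of the Koszul complex: the generators are f'
   and the x_a f0, and the Koszul part sits in the lower right blocks. *)
pose D0 : 'cV[R]_(s + 3) := col_mx f' (vars k *m f0).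
pose D1 : 'M[R]_((1 + s) + 3, s + 3) := block_mx Q' L 0 K2.
pose D2 : 'M[R]_(1 + 1, (1 + s) + 3) := block_mx w c0 0 K3.
have D10 : D1 *m D0 = 0.
  rewrite /D1 /D0 mul_block_col mul0mx add0r !mulmxA LE koszul2_vars mul0mx.
  by rewrite addrC Qf' col_mx0.
have D21 : D2 *m D1 = 0.
  rewrite /D2 /D1 mulmx_block !mul0mx !mulmx0 !addr0 !add0r wQ' c0E koszul32.
  by rewrite addNr block_mx0.
pose d1 := nseq s s ++ nseq 3 (s + 1)%N; pose d2 := nseq (s + 4) (s + 2)%N.
pose d3 := [:: 2 * s + 2; s + 3]%N.
have d1l (i : 'I_s) : nth 0%N d1 (lshift 3 i) = s.
  by rewrite nth_cat size_nseq /= ltn_ord nth_nseq ltn_ord.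
have d1r (i : 'I_3) : nth 0%N d1 (rshift s i) = (s + 1)%N.
  rewrite nth_cat size_nseq /= ltnNge leq_addr /= addKn.
  by case: i => -[|[|[|i]]].
have d2E (i : 'I_(1 + s + 3)) : nth 0%N d2 i = (s + 2)%N.
  by rewrite nth_nseq (_ : (i < s + 4)%N) //; have := ltn_ord i; lia.
have h0 : homogmx (fun a => nth 0%N d1 a) (fun=> 0%N) D0.
  apply: dhomog_homogmx => a b; left; split=> //; rewrite subn0 ord1.
  case: (split_ordP a) => i ->.
    by rewrite d1l col_mxEu -(col_mxEd f0).
  rewrite d1r (addnC s 1%N) col_mxEd mxE big_ord1 [vars k i 0]mxE.
  apply: dhomogM; first by rewrite dhomogX /= mdeg1.
  by have := f_homog (lshift s 0); rewrite col_mxEu.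
have h1 : homogmx (fun a => nth 0%N d2 a) (fun a => nth 0%N d1 a) D1.
  apply: dhomog_homogmx => a b; left; rewrite d2E.
  case: (split_ordP b) => j ->; rewrite ?d1l ?d1r.
    rewrite leq_addr addKn; split=> //.
    case: (split_ordP a) => i ->; rewrite /D1 ?block_mxEul ?block_mxEdl.
      by rewrite mxE.
    by rewrite mxE dhomog0.
  rewrite leq_add2l subnDl; split=> //.
  case: (split_ordP a) => i ->; rewrite /D1 ?block_mxEur ?block_mxEdr.
    exact: (homogmx_dhomog i j hL).
  exact: koszul2_homog.
have h2 : homogmx (fun a => nth 0%N d3 a) (fun a => nth 0%N d2 a) D2.
  apply: dhomog_homogmx => a b; left; rewrite d2E.
  case: (split_ordP a) => i ->; rewrite ord1 /=.
    split; first by lia.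
    rewrite (_ : 2 * s + 2 - (s + 2) = s)%N; last by lia.
    case: (split_ordP b) => j ->; rewrite /D2 ?block_mxEul ?block_mxEur //.
    by have := homogmx_dhomog 0 j hc0; rewrite addnK.
  split; first by lia.
  rewrite (_ : s + 3 - (s + 2) = 1)%N; last by lia.
  case: (split_ordP b) => j ->; rewrite /D2 ?block_mxEdl ?block_mxEdr.
    by rewrite mxE dhomog0.
  exact: koszul3_homog.
apply: (length3_resolution (D0 := D0) (D1 := D1) (D2 := D2)) => //.
- by rewrite size_cat !size_nseq.
- by rewrite size_nseq; lia.
- apply: mcoeff0_eq0 h0 _ => a b; case: (split_ordP a) => i ->.
    by rewrite d1l; lia.
  by rewrite d1r; lia.
- apply: mcoeff0_eq0 h1 _ => a b; rewrite d2E; case: (split_ordP b) => i ->.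
    by rewrite d1l; lia.
  by rewrite d1r; lia.
- apply: mcoeff0_eq0 h2 _ => a b; rewrite d2E.
  by case: (split_ordP a) => i ->; rewrite ord1 /=; lia.
(* A relation (a, b) on f' and the x_a f0 is the syzygy (b vars, a) of f, hence equals p Q for some
   p; then b - p L is a Koszul cycle. *)
- move=> v; split=> [v0|[u ->]]; last by rewrite -mulmxA D10 mulmx0.
  rewrite -[v]hsubmxK in v0 *; move: (lsubmx v) (rsubmx v) v0 => a b.
  rewrite mul_row_col mulmxA => v0.
  have [|p] := exQ (v := row_mx (b *m vars k) a); first by rewrite vf addrC.
  rewrite vQ => /eq_row_mx [bE aE].
  have [|c hc] := @koszul2_exact k (b - p *m L).
    by rewrite mulmxBl -mulmxA LE bE subrr.
  exists (row_mx p c); rewrite mul_row_block mulmx0 addr0 -hc aE.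
  by rewrite addrC subrK.
(* From p L = - c K2 follows p q0 = p L vars = 0, so p Q = 0 and p = r w; then c - r c0 is killed by
   K2 and is a multiple of K3. *)
- move=> v; split=> [v0|[u ->]]; last by rewrite -mulmxA D21 mulmx0.
  rewrite -[v]hsubmxK in v0 *; move: (lsubmx v) (rsubmx v) v0 => p c.
  rewrite mul_row_block mulmx0 addr0 -row_mx0 => /eq_row_mx [pQ' pL].
  have pq0 : p *m q0 = 0.
    move/eqP: pL; rewrite addr_eq0 => /eqP pL.
    by rewrite -LE mulmxA pL mulNmx -mulmxA koszul2_vars mulmx0 oppr0.
  have [|r pE] := exw (v := p); first by rewrite vQ pq0 pQ' row_mx0.
  have [|t ct] := @koszul3_exact k (c - r *: c0).
    move: pL; rewrite pE -scalemxAl c0E mulmxBl -scalemxAl => <-.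
    by rewrite scalerN addrC.
  exists (row_mx r%:M t%:M); rewrite mul_row_block mulmx0 addr0.
  by rewrite !mul_scalar_mx -pE -ct addrC subrK.
- move=> v v0; rewrite -[v]hsubmxK in v0 *.
  move: (lsubmx v) (rsubmx v) v0 => r t.
  rewrite [r]mx11_scalar [t]mx11_scalar mul_row_block mulmx0 addr0.
  rewrite !mul_scalar_mx -row_mx0 => /eq_row_mx [/w_tors ->].
  by rewrite scale0r add0r => /K3_neq0 ->; rewrite !raddf0 row_mx0.
Qed.

End MappingCone.

(** * Socles and compressed algebras *)

Section SocleAndPieces.

Variable k : fieldType.
Local Notation R := (poly3 k).
Implicit Types (J I : {pred R}).

Lemma piece_basis J d (U : {vspace hrow k 1 d}) :
  is_piece J U -> exists f : 'cV[R]_(\dim U),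
  [/\ forall i, f i 0 \is d.-homog, forall i, f i 0 \in J,
      forall p, p \in J -> p \is d.-homog -> exists v, p%:M = v *m f
    & forall c, map_mx (@mpolyC 3 k) c *m f = 0 :> 'rV_1 -> c = 0].
Proof.
move=> hU; exists (\col_i rowof (vbasis U)`_i 0 0); split=> [i|i|p pJ hp|c].
- by rewrite mxE rowof_homog.
- by rewrite mxE -hU; apply/vbasis_mem/mem_nth; rewrite size_tuple.
- have hp' i : (p%:M : 'rV_1) 0 i \is d.-homog by rewrite ord1 mxE.
  have pU : hrow_of d p%:M \in U by rewrite hU hrow_ofK // mxE eqxx.
  exists (\row_i (coord (vbasis U) i (hrow_of d p%:M))%:MP).
  rewrite -{1}(hrow_ofK hp') {1}(coord_vbasis pU) rowof_sum.
  apply/rowP => j; rewrite ord1 summxE [RHS]mxE; apply: eq_bigr => i _.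
  by rewrite !mxE.
- move=> cf; apply/rowP => i; rewrite [RHS]mxE.
  have /freeP free_U := basis_free (vbasisP U).
  apply: (free_U (fun i => c 0 i)).
  apply: rowof_inj; rewrite rowof0 rowof_sum -[RHS]cf; apply/rowP => j.
  by rewrite ord1 summxE [RHS]mxE; apply: eq_bigr => l _; rewrite !mxE.
Qed.

Lemma socle_piece0 J l p :
  socle_piece_dim J l 0 -> p \is l.-homog -> in_socle J p -> p \in J.
Proof. by move=> h hp sp; exact: (subquot_dim0 h (conj hp sp)). Qed.

Lemma socle_piece1 J l :
  idealr_closed J -> socle_piece_dim J l 1 ->
  exists b : R, [/\ b \is l.-homog, in_socle J b, b \notin J
    & forall p, p \is l.-homog -> in_socle J p -> exists c, p - c%:MP * b \in J].
Proof.
move=> [J0 _ JD] [b [hb indep gen]]; exists (b 0); have [h1 h2] := hb 0.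
split=> // [|p hp sp].
  apply/negP => bJ; have := indep (fun=> 1) _ 0; rewrite big_ord1 scale1r.
  by move/(_ bJ)/eqP; rewrite oner_eq0.
have [c] := gen _ (conj hp sp); rewrite big_ord1 => h.
by exists (c 0); rewrite mul_mpolyC.
Qed.

Lemma in_socle_next J l (p : R) :
  (forall q : R, q \is l.+1.-homog -> q \in J) -> p \is l.-homog -> in_socle J p.
Proof.
move=> h hp a; apply: h; apply: (dhomogM (d := 1) (e := l)) => //.
by rewrite dhomogX /= mdeg1.
Qed.

Lemma above_socle J t N :
  socle_shifts J [:: t] ->
  (forall i (p : R), (N < i)%N -> p \is i.-homog -> p \in J) ->
  forall i (p : R), (t < i)%N -> p \is i.-homog -> p \in J.
Proof.
move=> socJ topN i p lt; move: p.
have [m hm] : exists m, (N < i + m)%N by exists N.+1; lia.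
elim: m i lt hm => [|m IH] i lt hm p hp; first by apply: topN hp; lia.
have := socJ i; rewrite /= addn0 (_ : (t == i) = false); last by lia.
move=> soc0; apply: (socle_piece0 soc0 hp); apply: in_socle_next hp.
by apply: IH; lia.
Qed.

Lemma piece_full J d :
  (forall p : R, p \is d.-homog -> p \in J) -> is_piece J (fullv : {vspace hrow k 1 d}).
Proof. by move=> h u; rewrite memvf; apply/esym/h/rowof_homog. Qed.

Lemma socle_piece_dim_uniq J l m n :
  idealr_closed J -> socle_piece_dim J l m -> socle_piece_dim J l n -> m = n.
Proof.
move=> [J0 _ JD]; apply: subquot_dim_uniq => // c u v hu hv.
by rewrite -mul_mpolyC; exact: JD.
Qed.

Section Compressed.

Variables (s : nat) (I : {pred R}).
Hypotheses (s_gt1 : (1 < s)%N) (homI : homog_ideal I) (compI : compressed I)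
  (socI : socle_shifts I [:: s; 2 * s - 1]%N).

(** A nonzero form of top degree N is in the socle, so N is s or 2s - 1; the socle element of degree
    2s - 1 excludes a smaller N. *)
Lemma compressed_top i (p : R) : (2 * s - 1 < i)%N -> p \is i.-homog -> p \in I.
Proof.
have [N [c [[[q hq qI] topN] _ _]]] := compI.
suff <- : N = (2 * s - 1)%N by exact: topN.
have [idI _] := homI.
have sq : in_socle I q by apply: in_socle_next hq => r; apply: topN.
have N_soc : (N == s) || (N == 2 * s - 1)%N.
  apply: contraNT qI; rewrite negb_or => /andP[/negPf n1 /negPf n2].
  have := socI N; rewrite /= eq_sym n1 eq_sym n2 => soc0.
  exact: socle_piece0 soc0 hq sq.
have := socI (2 * s - 1)%N.
rewrite /= eqxx (_ : (s == 2 * s - 1)%N = false); last by lia.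
case/(socle_piece1 idI) => b [hb _ bI _].
have : ~~ (N < 2 * s - 1)%N by apply: contra bI => lt; exact: topN hb.
by lia.
Qed.

(** Only the socle degrees s and 2s - 1 enter the sum. For d >= s the first contributes 1 when d = s
    and nothing afterwards; the second contributes C(2s+1-d, 2). *)
Lemma compressed_piece d : (s <= d)%N -> (d <= 2 * s - 1)%N ->
  exists2 U : {vspace hrow k 1 d}, is_piece I U
    & (\dim U + (minn 'C(d.+2, 2) ((s == d) + 'C(2 * s + 1 - d, 2))) = 'C(d.+2, 2))%N.
Proof.
move=> le1 le2.
have [N [c [[[q hq qI] topN] soc hil]]] := compI; have [idI _] := homI.
have ltN : (2 * s - 1 <= N)%N.
  have := socI (2 * s - 1)%N.
  rewrite /= eqxx (_ : (s == 2 * s - 1)%N = false); last by lia.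
  case/(socle_piece1 idI) => b [hb _ bI _]; rewrite leqNgt.
  by apply: contra bI => lt; exact: topN hb.
have cE l : c l = ((s == l) + (2 * s - 1 == l))%N.
  by have := socle_piece_dim_uniq idI (soc l) (socI l); rewrite /= addn0.
have NE : N = (2 * s - 1)%N.
  apply/eqP; rewrite eqn_leq ltN andbT leqNgt; apply: contra qI => lt.
  exact: compressed_top hq.
have := hil d; rewrite NE => /(_ le2) /(quot_piece_vspace idI) [U hU dimU].
exists U => //; rewrite -[RHS]dimU; congr (_ + minn _ _)%N.
  by rewrite -[RHS]bin_sub ?leq_addl // addnK.
apply: esym; have lt_t : (2 * s - 1 < (2 * s - 1).+1)%N by [].
rewrite (bigD1 (Ordinal lt_t)) //= !cE eqxx.
rewrite (_ : (s == 2 * s - 1)%N = false); last by lia.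
rewrite add0n mul1n addnC (_ : 2 + (2 * s - 1) - d = 2 * s + 1 - d)%N; last by lia.
rewrite -[in RHS](bin_sub (m := 2)); last by lia.
rewrite (_ : 2 * s + 1 - d - 2 = 2 * s - 1 - d)%N; last by lia.
congr (_ + _)%N.
have lt_s : (s < (2 * s - 1).+1)%N by lia.
case: (eqVneq s d) => [sd|ne].
  rewrite (bigD1 (Ordinal lt_s)) /=; last first.
    by rewrite -sd leqnn -val_eqE /=; lia.
  rewrite cE eqxx (_ : (2 * s - 1 == s)%N = false); last by lia.
  rewrite big1; first by rewrite sd subnn bin0.
  move=> i /andP[/andP[_ i1] i2]; move: i1 i2; rewrite -!val_eqE /= cE => /negPf i1 /negPf i2.
  by have [-> ->] : (s == i)%N = false /\ (2 * s - 1 == i)%N = false by split; lia.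
rewrite big1 // => i /andP[di]; rewrite -val_eqE /= cE => /negPf ne2.
have sd : (s < d)%N by lia.
by have [-> ->] : (s == i)%N = false /\ (2 * s - 1 == i)%N = false by split; lia.
Qed.

End Compressed.

End SocleAndPieces.

(** * The socle element separating I from J *)

Section SocleExtension.

Variables (k : fieldType) (s : nat).
Local Notation R := (poly3 k).
Variables (I J : {pred R}).
Hypotheses (s_ge3 : (3 <= s)%N) (homI : homog_ideal I) (compI : compressed I)
  (socI : socle_shifts I [:: s; 2 * s - 1]%N)
  (homJ : homog_ideal J) (socJ : socle_degree J (2 * s - 1)%N)
  (sIJ : {subset I <= J})
  (eqIJ : forall d (p : R), (s < d)%N -> p \is d.-homog -> p \in J -> p \in I).

Let idI : idealr_closed I. Proof. by case: homI. Qed.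
Let idJ : idealr_closed J. Proof. by case: homJ. Qed.
Let s_gt1 : (1 < s)%N. Proof. exact: ltnW. Qed.

Lemma idealD (K : {pred R}) a p q :
  idealr_closed K -> p \in K -> q \in K -> a * p + q \in K.
Proof. by case=> _ _ h; exact: h. Qed.

Lemma idealZ (K : {pred R}) a p : idealr_closed K -> p \in K -> a * p \in K.
Proof. by move=> h pK; rewrite -[_ * _]addr0; apply: idealD => //; case: h. Qed.

(** For p in J of degree s, every x_a p lies in J in degree s + 1, hence in I. So p is in the socle
    of R/I, whose degree s part is spanned by b. *)
Lemma socle_generator : exists b : R,
  [/\ b \is s.-homog, in_socle I b, b \notin I, b \in J
    & forall p, p \is s.-homog -> p \in J -> exists c, p - c%:MP * b \in I].
Proof.
have := socI s; rewrite /= eqxx (_ : (2 * s - 1 == s)%N = false); last by lia.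
case/(socle_piece1 idI) => b [hb sb bI gen]; exists b; split=> // [|p hp pJ].
  have := socJ s; rewrite /= (_ : (2 * s - 1 == s)%N = false); last by lia.
  by move=> soc0; apply: (socle_piece0 soc0 hb) => a; apply: sIJ.
apply: gen => // a; apply: (eqIJ (d := s.+1)) => //.
  by apply: (dhomogM (d := 1) (e := s)) => //; rewrite dhomogX /= mdeg1.
exact: idealZ.
Qed.

(** The minimum is 1 + C(s+1, 2), because C(s+2, 2) exceeds C(s+1, 2) by s + 1; this leaves
    dimension s. *)
Lemma piece_at_s : exists2 U : {vspace hrow k 1 s}, is_piece I U & \dim U = s.
Proof.
have [||U hU dimU] := compressed_piece s_gt1 homI compI socI (d := s) => //.
  by lia.
exists U => //; move: dimU; rewrite eqxx.
have -> : (2 * s + 1 - s = s.+1)%N by lia.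
by rewrite [in 'C(s.+2, 2)]binS bin1; lia.
Qed.

(** Three ranges: in degree s, J is I plus the line of b; for s < d <= 2s - 1 it equals I; above 2s
    - 1 both contain everything. *)
Lemma pieceJ d : (s <= d)%N ->
  exists2 U : {vspace hrow k 1 d},
    is_piece J U & (\dim U + 'C(2 * s + 1 - d, 2) = 'C(d.+2, 2))%N.
Proof.
rewrite leq_eqVlt => /predU1P[<-|lt].
  have [U hU dimU] := piece_at_s.
  have [b [hb sb bI bJ gen]] := socle_generator.
  pose g : hrow k 1 s := hrow_of s b%:M.
  have gE : rowof g = b%:M by rewrite hrow_ofK // => i; rewrite ord1 mxE.
  have gU : g \notin U by rewrite hU gE mxE.
  have g0 : g != 0 by apply: contraNneq gU => ->; rewrite mem0v.
  exists (U + <[g]>)%VS => [u|].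
    apply/idP/idP => [/memv_addP[u1 u1U [_ /vlineP[c ->] ->]]|uJ].
      rewrite addrC rowofZD gE [X in X \in J]mxE mxE.
      rewrite [b%:M 0 0]mxE eqxx; apply: idealD => //; apply: sIJ.
      by rewrite -hU.
    have [c hc] := gen _ (rowof_homog u 0) uJ.
    rewrite -(subrK (c *: g) u); apply: memv_add; last exact: memvZ (memv_line g).
    rewrite hU addrC -scaleNr rowofZD gE mpolyCN scaleNr addrC.
    by move: hc; rewrite !mxE eqxx.
  rewrite dimv_disjoint_sum; last first.
    apply/eqP; rewrite -subv0; apply/subvP => u /memv_capP[uU /vlineP[c uc]].
    move: uU; rewrite uc memv0; case: (eqVneq c 0) => [->|c0].
      by rewrite scale0r eqxx.
    by rewrite rpredZeq (negPf c0) (negPf gU).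
  rewrite dimU dim_vline g0 (_ : 2 * s + 1 - s = s.+1)%N; last by lia.
  by rewrite [in RHS]binS bin1; lia.
have [le|gt] := leqP d (2 * s - 1)%N.
  have [|U hU dimU] := compressed_piece s_gt1 homI compI socI _ le.
    exact: ltnW.
  exists U => [u|].
    rewrite hU; apply/idP/idP => [/sIJ //|]; apply: eqIJ lt _.
    exact: rowof_homog.
  rewrite -dimU (_ : (s == d) = false) ?(minn_idPr _) //; last by lia.
  by apply: leq_bin2l; lia.
exists fullv.
  apply: piece_full => p hp; apply: sIJ.
  exact: (compressed_top s_gt1 homI compI socI gt hp).
by rewrite dim_hrow mul1n (@bin_small (_ - d)) ?addn0 //; lia.
Qed.

Section Syzygies.

Variables (b : R) (f' : 'cV[R]_s).
Hypotheses (b_homog : b \is s.-homog) (b_socle : in_socle I b) (bI : b \notin I)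
  (bJ : b \in J)
  (b_gen : forall p, p \is s.-homog -> p \in J -> exists c, p - c%:MP * b \in I)
  (f'_homog : forall i, f' i 0 \is s.-homog) (f'I : forall i, f' i 0 \in I)
  (f'_gen : forall p, p \in I -> p \is s.-homog -> exists v, p%:M = v *m f')
  (f'_free : forall c, map_mx (@mpolyC 3 k) c *m f' = 0 :> 'rV_1 -> c = 0).

Local Notation f := (col_mx b%:M f').

Lemma gens_homog i : f i 0 \is s.-homog.
Proof.
by case: (split_ordP i) => j ->; rewrite ?col_mxEu ?col_mxEd // ord1 mxE eqxx.
Qed.

Lemma gens_homogmx : homogmx (fun=> s) (fun=> 0%N) f.
Proof. by apply: dhomog_homogmx => i j; left; rewrite subn0 ord1 gens_homog. Qed.

Lemma gens_in i : f i 0 \in J.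
Proof.
case: (split_ordP i) => j ->; rewrite ?col_mxEu ?col_mxEd ?ord1 ?mxE ?eqxx //.
exact: sIJ.
Qed.

Lemma gens_span p : p \in J -> p \is s.-homog -> exists v, p%:M = v *m f.
Proof.
move=> pJ hp; have [c hc] := b_gen hp pJ.
have [|v hv] := f'_gen hc.
  by apply: rpredB => //; rewrite mul_mpolyC; apply: dhomogZ.
exists (row_mx (c%:MP)%:M v); rewrite mul_row_col -hv -scalar_mxM -raddfD /=.
by rewrite addrC subrK.
Qed.

Lemma socle_gen_const (c : k) : c%:MP * b \in I -> c = 0.
Proof.
move=> cb; apply: contraNeq bI => c0.
by have := idealZ c^-1%:MP idI cb; rewrite mulrA -mpolyCM mulVf // mul1r.
Qed.

Lemma span_f'_in (v : 'rV[R]_s) : (v *m f') 0 0 \in I.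
Proof. by rewrite mxE; apply: ideal_sum. Qed.

(** A vector of degree s is constant here. Its coefficient at b vanishes because b is not in I while
    the f' are, and the remaining ones vanish because f' is independent over k. *)
Lemma gens_free (v : 'rV[R]_(1 + s)) :
  homogmx (fun=> s) (fun=> s) v -> v *m f = 0 -> v = 0.
Proof.
move=> hv; have vC i : v 0 i = ((v 0 i)@_0%MM)%:MP.
  by apply: homog0_mpolyC; have := homogmx_dhomog 0 i hv; rewrite subnn.
have -> : v = map_mx (@mpolyC 3 k) (map_mx (mcoeff 0%MM) v).
  by apply/rowP => i; rewrite !mxE -vC.
move: (map_mx (mcoeff _) v) => c {v hv vC}.
rewrite -[c]hsubmxK; move: (lsubmx c) (rsubmx c) => a d {c}.
rewrite map_row_mx mul_row_col [map_mx _ a]mx11_scalar mxE -scalar_mxM => e.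
have a0 : a 0 0 = 0.
  apply: socle_gen_const; rewrite -[_ * b]subr0.
  have -> : (a 0 0)%:MP * b - 0 = (-1) * (map_mx (@mpolyC 3 k) d *m f') 0 0.
    move/rowP/(_ 0): e; rewrite [LHS]mxE [X in X + _]mxE eqxx [RHS]mxE => /eqP.
    by rewrite addr_eq0 => /eqP; rewrite subr0 mulN1r.
  by apply: idealZ => //; apply: span_f'_in.
move: e; rewrite a0 mpolyC0 mul0r raddf0 add0r => /f'_free ->.
by apply/rowP => i; rewrite !mxE; case: split => j; rewrite !mxE ?mpolyC0.
Qed.

(** Write p in I as a b + c f'. Then a b is in I; since the x_i b are in I and b is not, a has no
    constant term, so a b is a combination of the x_i b. *)
Lemma socle_gens p :
  (p \in I -> exists v, p%:M = v *m f) ->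
  p \in I <-> exists v, p%:M = v *m col_mx f' (vars k *m b%:M).
Proof.
move=> gen; split=> [pI|[v pv]]; last first.
  have -> : p = (p%:M : 'M_1) 0 0 by rewrite mxE eqxx.
  rewrite pv -[v]hsubmxK mul_row_col mxE -[X in X + _]mul1r.
  apply: idealD => //; first exact: span_f'_in.
  rewrite mxE; apply: ideal_sum => // i.
  by rewrite mxE big_ord1 [vars k i 0]mxE [b%:M 0 0]mxE eqxx; apply: b_socle.
have [v] := gen pI; rewrite -[v]hsubmxK.
move: (lsubmx v) (rsubmx v) => a c {v}; rewrite mul_row_col => pE.
have abI : a 0 0 * b \in I.
  have e : p = a 0 0 * b + (c *m f') 0 0.
    move/rowP/(_ 0): pE; rewrite mul_mx_scalar [LHS]mxE eqxx [RHS]mxE [X in _ = X + _]mxE.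
    by rewrite mulr1n mulrC.
  have -> : a 0 0 * b = (-1) * (c *m f') 0 0 + p.
    by rewrite e mulN1r addrCA addNr addr0.
  by apply: idealD => //; exact: span_f'_in.
have a0 : (a 0 0)@_0%MM = 0.
  have [|q hq] := @mpoly3_maxl k (a 0 0 - ((a 0 0)@_0%MM)%:MP).
    by rewrite mcoeffB mpolyCK subrr.
  apply: socle_gen_const; rewrite -[_%:MP](subKr (a 0 0)) mulrBl hq.
  rewrite addrC -mulN1r; apply: idealD => //; rewrite mulr_suml.
  elim/big_rec: _ => [|i r _ hr]; first by case: idI.
  by rewrite -mulrA mulrCA; apply: idealD => //; exact: b_socle.
have [q hq] := mpoly3_maxl a0.
exists (row_mx c (\row_i q i)); rewrite mul_row_col mulmxA pE addrC.
congr (_ + _ *m _); apply/rowP => i; rewrite ord1 hq [RHS]mxE.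
by apply: eq_bigr => j _; rewrite !mxE mulrC.
Qed.

End Syzygies.

End SocleExtension.

(** * Assembling the resolution of R/I *)

Section CompressedResolution.

Variables (k : fieldType) (s : nat).
Local Notation R := (poly3 k).

Lemma minimal_resolution (I J : {pred R}) :
  (3 <= s)%N -> homog_ideal I -> compressed I ->
  socle_shifts I [:: s; 2 * s - 1]%N ->
  homog_ideal J -> socle_degree J (2 * s - 1)%N -> {subset I <= J} ->
  (forall d (p : R), (s < d)%N -> p \is d.-homog -> p \in J -> p \in I) ->
  betti_numbers J (betti_table
    [:: (0, 0, 1); (1, s, s + 1); (2, s + 2, s + 1); (3, 2 * s + 2, 1)]%N) ->
  exists F : gfree k,
    [/\ resolves F I, minimal F
      & shifts F = shifts3 (nseq s s ++ nseq 3 (s + 1)%N) (nseq (s + 4)%N (s + 2)%N)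
                           [:: 2 * s + 2; s + 3]%N].
Proof.
move=> s3 homI compI socI homJ socJ sIJ eqIJ [F resF betF].
have [b [hb sb bI bJ b_gen]] :=
  socle_generator s3 homI socI homJ socJ sIJ eqIJ.
have [U hU dimU] := piece_at_s s3 homI compI socI.
have := piece_basis hU; rewrite dimU => -[f' [f'h f'I f'gen f'free]].
pose f : 'cV[R]_(1 + s) := col_mx b%:M f'.
have f_homog := gens_homog hb f'h.
have f_homogmx := gens_homogmx hb f'h.
have fJ := gens_in sIJ bJ f'I.
have tor1 j : j != s -> subquot_dim (@tor_cycle k F 1 j) (@tor_boundary k F 1 j) 0.
  move=> /negPf ne; have := betF 1%N j; rewrite /betti_table !big_cons big_nil /=.
  by rewrite !xpair_eqE /= [s == j]eq_sym ne.
have tor2 j : j != (s + 2)%N ->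
    subquot_dim (@tor_cycle k F 2 j) (@tor_boundary k F 2 j) 0.
  move=> /negPf ne; have := betF 2%N j; rewrite /betti_table !big_cons big_nil /=.
  by rewrite !xpair_eqE /= [(s + 2)%N == j]eq_sym ne.
have gen := tor1_generators resF homJ (gens_span hb b_gen f'gen) tor1.
have genJ p : p \in J <-> exists v, p%:M = v *m f.
  split=> [/gen //|[v hv]].
  have := span_in_ideal homJ fJ v; rewrite -/f -hv mxE eqxx; exact.
have dimJ := pieceJ s3 homI compI socI homJ socJ sIJ eqIJ.
have [|Q [Qh Qf Qgen]] := quadratic_syzygies f_homog genJ dimJ; first by lia.
have exQ (v : 'rV[R]_(1 + s)) : v *m f = 0 -> exists u, v = u *m Q.
  apply: (tor2_syzygies resF homJ fJ f_homogmx
            (G := fun v => exists u, v = u *m Q) gen _ _ _ _ _ tor2) => {v}.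
  - by exists 0; rewrite mul0mx.
  - by move=> _ _ [u ->] [v ->]; exists (u + v); rewrite mulmxDl.
  - by move=> a _ [u ->]; exists ('X_a *: u); rewrite scalemxAl.
  - move=> v hv v0; exact: (gens_free homI bI f'I f'free hv v0).
  - move=> v hv; apply: Qgen => i.
    by have := homogmx_dhomog 0 i hv; rewrite addKn.
have [w [wh w0 wQ exw]] := second_syzygies f_homog genJ dimJ Qh Qf exQ.
have I0 : 0 \in I by case: homI => -[].
apply: (socle_extension_resolution (f0 := b%:M) (f' := f') (Q := Q) (w := w)) => //.
  by lia.
move=> p; apply: (socle_gens homI sb bI f'I) => pI; exact: gen (sIJ _ pI).
Qed.

End CompressedResolution.

Local Close Scope ring_scope.

Theorem corollary5p7 (k : fieldType) (s : nat) (I I1 I2 : {pred poly3 k}) :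
  (3 <= s)%N -> ~~ odd s ->
  homog_ideal I -> has_grade I 3 ->
  compressed I -> socle_shifts I [:: s; 2 * s - 1]%N ->
  (forall p, (p \in I) = (p \in I1) && (p \in I2)) ->
  gorenstein3 I1 -> gorenstein3 I2 ->
  socle_degree I1 s -> socle_degree I2 (2 * s - 1)%N ->
  betti_numbers I2 (betti_table
    [:: (0, 0, 1); (1, s, s + 1); (2, s + 2, s + 1); (3, 2 * s + 2, 1)]%N) ->
  (exists F : gfree k,
     [/\ resolves F I, minimal F &
         [/\ shifts F 0 = [:: 0%N],
             shifts F 1 = nseq s s ++ nseq 3 (s + 1)%N,
             shifts F 2 = nseq (s + 4) (s + 2)%N,
             shifts F 3 = [:: 2 * s + 2; s + 3]%N
           & forall i, (3 < i)%N -> shifts F i = [::]]])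
  /\ betti_numbers I (betti_table
    [:: (0, 0, 1); (1, s, s); (1, s + 1, 3); (2, s + 2, s + 4);
        (3, s + 3, 1); (3, 2 * s + 2, 1)]%N).
Proof.
move=> s3 _ homI _ compI socI def_I [homI1 _ _] [homI2 _ _] soc1 soc2 bet2.
have sI1 : {subset I <= I1} by move=> p; rewrite def_I => /andP[].
have sI2 : {subset I <= I2} by move=> p; rewrite def_I => /andP[].
(* I contains all forms of degree above 2s - 1, and so does I_1; this starts the descent to degree s
   in R/I_1. *)
have topI1 := above_socle soc1 (fun i p lt hp =>
  sI1 _ (compressed_top (ltnW s3) homI compI socI (i := i) (p := p) lt hp)).
have eqI d (p : poly3 k) : (s < d)%N -> p \is d.-homog -> p \in I2 -> p \in I.
  by move=> lt hp pI2; rewrite def_I pI2 (topI1 _ _ lt hp).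
have [F [resF minF shF]] :=
  minimal_resolution s3 homI compI socI homI2 soc2 sI2 eqI bet2.
split.
  exists F; split=> //; rewrite shF; split=> // -[|[|[|[|i]]]] //.
apply: (minimal_betti resF minF) => i j; rewrite shF.
rewrite /betti_table !big_cons big_nil /= !xpair_eqE.
case: i => [|[|[|[|i]]]] //=; rewrite ?count_cat ?count_nseq /=.
all: by do ?case: eqP => ? /=; lia.
Qed.
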